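(* Let $k,l,n,m\in\mathbb{Z}^+$ and let $L$ be a tense logic extending $\mathsf{S4BP}^{k,l}_{n,m}$. Then $L$ is pretabular if and only if $L=\mathsf{Log}(\mathfrak{F}^x_\omega)$ for some c-irreducible rooted pre-skeleton $\mathfrak{F}^x_\omega$.
   Context: Tense formulas use $\Box$, $\Diamond=\neg\Box\neg$ and a past possibility operator written here $\mathsf{P}$; $\mathsf{S4}_t=\mathsf{K}_t\oplus\{\Box p\to p,\Box p\to\Box\Box p\}$. With $\Delta\phi=\phi\vee\Diamond\phi\vee\mathsf{P}\phi$, $\Delta^{j+1}\phi=\Delta\Delta^j\phi$: $\mathbf{bz}_l=\Delta^{l+1}p\to\Delta^lp$; $\mathbf{bw}^+_n=\bigwedge_{i\leq n}\Diamond p_i\to\bigvee_{i\neq j\leq n}\Diamond(p_i\wedge(p_j\vee\Diamond p_j))$; $\mathbf{bw}^-_m$ the same with $\mathsf{P}$ for $\Diamond$; $\mathbf{bd}_1=\Diamond\Box p_0\to p_0$, $\mathbf{bd}_{j+1}=\Diamond(\Box p_j\wedge\neg\mathbf{bd}_j)\to p_j$. $\mathsf{S4BP}^{k,l}_{n,m}=\mathsf{S4}_t\oplus\{\mathbf{bd}_k,\mathbf{bz}_l,\mathbf{bw}^+_n,\mathbf{bw}^-_m\}$. All frames are reflexive and transitive. A frame is a skeleton if all its clusters ($R[x]\cap R^{-1}[x]$) are singletons. For a frame $\mathfrak{F}=(X,R)$, $x\in X$ and $0<\lambda\leq\omega$, $\mathfrak{F}^x_\lambda$ is obtained by replacing $x$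 by a cluster $\{x\}\cup\{x_i:0<i\leq\lambda\}$ all of whose points have the successors and predecessors of $x$; it is a ($\lambda$-)pre-skeleton if $\mathfrak{F}$ is a skeleton. A t-morphism is a map $f$ with $f[R[y]]=R'[f(y)]$ and $f[R^{-1}[y]]=R'^{-1}[f(y)]$ for all $y$; $\mathsf{TM}(\mathcal{K})$ is the class of surjective t-morphic images and $\mathsf{IM}(\mathcal{K})$ the class of isomorphic copies of frames in $\mathcal{K}$. $\mathfrak{F}^x_\lambda$ is c-irreducible if $\mathsf{TM}(\mathfrak{F}^x_\lambda)=\mathsf{IM}(\{\mathfrak{F}^x_j:0<j\leq\lambda\})\cup\mathsf{TM}(\mathfrak{F})$. A logic is pretabular if it is not the logic of a finite frame but all its consistent proper extensions are. *)

(* Defs.v *)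
From Stdlib Require Import Relation_Operators.
From mathcomp Require Import all_boot.
From mathcomp Require Import boolp classical_sets functions cardinality.

Set Implicit Arguments.
Unset Strict Implicit.
Unset Printing Implicit Defensive.

Local Open Scope classical_set_scope.

(** * Tense formulas *)

Inductive form : Type :=
| Var of nat
| Bot
| Imp of form & form
| Box of form
| Past of form.  (* past possibility *)

Definition Neg (a : form) : form := Imp a Bot.
Definition Top : form := Neg Bot.
Definition Or (a b : form) : form := Imp (Neg a) b.
Definition And (a b : form) : form := Neg (Imp a (Neg b)).
Definition Dia (a : form) : form := Neg (Box (Neg a)).
Definition PastBox (a : form) : form := Neg (Past (Neg a)).

Fixpoint subst (s : nat -> form) (a : form) : form :=
  match a with
  | Var i => s i
  | Bot => Bot
  | Imp b c => Imp (subst s b) (subst s c)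
  | Box b => Box (subst s b)
  | Past b => Past (subst s b)
  end.

(* Boolean value of a formula, where variables and modalised subformulas are
   treated as propositional atoms. *)
Fixpoint beval (v : form -> bool) (a : form) : bool :=
  match a with
  | Bot => false
  | Imp b c => beval v b ==> beval v c
  | _ => v a
  end.

Definition tautology (a : form) : Prop := forall v, beval v a.

(** * Tense logics *)

Record tense_logic (L : set form) : Prop := {
  tl_taut : forall a, tautology a -> L a;
  tl_K_box : forall a b, L (Imp (Box (Imp a b)) (Imp (Box a) (Box b)));
  tl_K_pastbox : forall a b,
    L (Imp (PastBox (Imp a b)) (Imp (PastBox a) (PastBox b)));
  tl_box_past : forall a, L (Imp a (Box (Past a)));
  tl_pastbox_dia : forall a, L (Imp a (PastBox (Dia a)));
  tl_mp : forall a b, L (Imp a b) -> L a -> L b;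
  tl_nec_box : forall a, L a -> L (Box a);
  tl_nec_pastbox : forall a, L a -> L (PastBox a);
  tl_subst : forall s a, L a -> L (subst s a)
}.

Definition oplus (L G : set form) : set form :=
  smallest tense_logic (L `|` G).

Definition Kt : set form := smallest tense_logic set0.

Definition S4t : set form :=
  let p := Var 0 in
  oplus Kt [set Imp (Box p) p; Imp (Box p) (Box (Box p))].

Definition Delta (a : form) : form := Or a (Or (Dia a) (Past a)).

Definition bz (l : nat) : form :=
  Imp (iter l.+1 Delta (Var 0)) (iter l Delta (Var 0)).

(* The index set is {0, ..., n}, so there are n + 1 variables. *)
Definition bw (D : form -> form) (n : nat) : form :=
  Imp (\big[And/Top]_(i < n.+1) D (Var i))
      (\big[Or/Bot]_(i < n.+1) \big[Or/Bot]_(j < n.+1 | i != j)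
         D (And (Var i) (Or (Var j) (D (Var j))))).

Definition bw_plus (n : nat) : form := bw Dia n.
Definition bw_minus (m : nat) : form := bw Past m.

(* bd_1 := Dia Box p_0 -> p_0, bd_(j+1) := Dia (Box p_j /\ ~ bd_j) -> p_j;
   the value at 0 is a dummy. *)
Fixpoint bd (k : nat) : form :=
  match k with
  | 0 => Bot
  | j.+1 =>
    match j with
    | 0 => Imp (Dia (Box (Var 0))) (Var 0)
    | _.+1 => Imp (Dia (And (Box (Var j)) (Neg (bd j)))) (Var j)
    end
  end.

Definition S4BP (k l n m : nat) : set form :=
  oplus S4t [set a | a = bd k \/ a = bz l \/ a = bw_plus n \/ a = bw_minus m].

(** * Frames *)

Record frame : Type := Frame {
  carrier :> Type;
  acc : carrier -> carrier -> Prop;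
  frame_inhabited : inhabited carrier;
  acc_refl : forall x, acc x x;
  acc_trans : forall x y z, acc x y -> acc y z -> acc x z
}.

Definition succs (F : frame) (x : F) : set F := [set y | acc x y].
Definition preds (F : frame) (x : F) : set F := [set y | acc y x].

Fixpoint sat (F : frame) (V : nat -> set F) (a : form) : set F :=
  match a with
  | Var i => V i
  | Bot => set0
  | Imp b c => [set x | sat V b x -> sat V c x]
  | Box b => [set x | forall y, succs x y -> sat V b y]
  | Past b => [set x | exists2 y, preds x y & sat V b y]
  end.

Definition Log (F : frame) : set form := [set a | forall V x, sat (F := F) V a x].

(* Rootedness in the bimodal sense: the frame is generated by a single point
   under the relation together with its converse. *)
Definition rooted (F : frame) : Prop :=
  exists r : F, forall y : F, clos_refl_sym_trans F (@acc F) r y.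

Definition cluster (F : frame) (x : F) : set F := succs x `&` preds x.

Definition skeleton (F : frame) : Prop := forall x : F, cluster x = [set x].

Definition t_morphism (F G : frame) (f : F -> G) : Prop :=
  forall y : F, f @` succs y = succs (f y) /\ f @` preds y = preds (f y).

Definition isomorphic (F G : frame) : Prop :=
  exists2 f : F -> G, bijective f & forall y z, acc y z <-> acc (f y) (f z).

Definition TM (K : set frame) : set frame :=
  [set G : frame | exists2 F : frame, K F & exists2 f : F -> G, t_morphism f & range f = setT].

Definition IM (K : set frame) : set frame :=
  [set G : frame | exists2 F : frame, K F & isomorphic F G].

(** * Pre-skeletons *)

(* The ordinals up to and including omega. *)
Inductive ord_omega : Type := Fin of nat | Omega.

Definition leo (a b : ord_omega) : bool :=
  match a, b with
  | Fin i, Fin j => i <= j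
  | _, Omega => true
  | Omega, Fin _ => false
  end.

Definition lto (a b : ord_omega) : bool := ~~ leo b a.

Section Blowup.
Variables (F : frame) (x : F) (lambda : ord_omega).

Definition blowup_carrier : Type :=
  (F + {i : ord_omega | lto (Fin 0) i && leo i lambda})%type.

Definition blowup_proj (u : blowup_carrier) : F :=
  match u with inl y => y | inr _ => x end.

Definition blowup_acc (u v : blowup_carrier) : Prop :=
  acc (blowup_proj u) (blowup_proj v).

Lemma blowup_inhabited : inhabited blowup_carrier.
Proof. exact: (inhabits (inl x)). Qed.

Lemma blowup_refl u : blowup_acc u u.
Proof. exact: acc_refl. Qed.

Lemma blowup_trans u v w : blowup_acc u v -> blowup_acc v w -> blowup_acc u w.
Proof. exact: acc_trans. Qed.

(* The point x is kept as [inl x], and the new points [inr i], 0 < i <= lambda,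
   have exactly the successors and predecessors of x. *)
Definition blowup : frame :=
  Frame blowup_inhabited blowup_refl blowup_trans.

End Blowup.

Definition c_irreducible (F : frame) (x : F) (lambda : ord_omega) : Prop :=
  TM [set blowup x lambda] =
  IM [set G : frame | exists2 j, lto (Fin 0) j && leo j lambda & G = blowup x j]
  `|` TM [set F].

(** * Tabularity and pretabularity *)

Definition consistent (L : set form) : Prop := ~ L Bot.

Definition tabular (L : set form) : Prop :=
  exists2 F : frame, finite_set [set: F] & L = Log F.

(* Frames are nonempty, so the inconsistent logic is not the logic of any frame;
   the clause [consistent L] keeps it from being vacuously pretabular. *)
Definition pretabular (L : set form) : Prop :=
  [/\ consistent L, ~ tabular L &
      forall L', tense_logic L' -> L `<` L' -> consistent L' -> tabular L'].

(* Main.v *)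
(* Let L extend S4BP. The modal axioms bound depth, width and zigzag diameter
   already on the canonical frame of L cut down to finitely many variables,
   because distinct clusters there are separated by formulas. Hence L has the
   finite model property with respect to finite rooted frames having boundedly
   many clusters, and L can fail to be tabular only if it has frames with
   arbitrarily large clusters. Collapsing the other clusters and applying the
   pigeonhole principle to the finitely many skeletons gives a skeleton S with
   L included in Log(S^x_omega), so a pretabular L equals this logic. If S is
   chosen with as few points as possible, then a t-morphism on S^x_omega that is
   not constant on the cluster of x sends no other point into the image of that
   cluster; so it induces a t-morphism from S^x_omega to a blow-up of the
   skeleton of its image and must be injective on S. Conversely, the
   characteristic formulas of finite rooted frames show that such a frame
   validates Log(S^x_omega) only if it is a t-morphic image of S^x_omega, and by
   c-irreducibility a proper extension leaves room for finitely many of them. *)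

Require Import Defs.
From Stdlib Require Import Relation_Operators Operators_Properties.
From mathcomp Require Import all_boot.
From mathcomp Require Import boolp classical_sets functions cardinality.

Set Implicit Arguments.
Unset Strict Implicit.
Unset Printing Implicit Defensive.

Local Open Scope classical_set_scope.

(** * Semantics *)

Lemma sat_Imp (F : frame) V a b (x : F) :
  sat V (Imp a b) x <-> (sat V a x -> sat V b x).
Proof. by []. Qed.

Lemma sat_Neg (F : frame) V a (x : F) : sat V (Neg a) x <-> ~ sat V a x.
Proof. by []. Qed.

Lemma sat_Or (F : frame) V a b (x : F) :
  sat V (Or a b) x <-> sat V a x \/ sat V b x.
Proof.
split=> [h|[ha|hb] //=].
by case: (pselect (sat V a x)) => ?; [left|right; apply: h].
Qed.

Lemma sat_And (F : frame) V a b (x : F) :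
  sat V (And a b) x <-> sat V a x /\ sat V b x.
Proof.
split=> [h|[ha hb] /= h]; last exact: h.
by split; apply: contrapT => n; apply: h => //= ? ?.
Qed.

Lemma sat_Dia (F : frame) V a (x : F) :
  sat V (Dia a) x <-> exists2 y, acc x y & sat V a y.
Proof.
split=> [h|[y xy ay] /= h]; last exact: (h y).
by apply: contrapT => n; apply: h => y xy ay; apply: n; exists y.
Qed.

Lemma sat_Past (F : frame) V a (x : F) :
  sat V (Past a) x <-> exists2 y, acc y x & sat V a y.
Proof. by []. Qed.

Lemma sat_bigAndP (F : frame) V (I : eqType) (r : seq I) (P : pred I)
    (f : I -> form) (x : F) :
  sat V (\big[And/Top]_(i <- r | P i) f i) x <->
  forall i, i \in r -> P i -> sat V (f i) x.
Proof.
elim: r => [|i r IH]; first by rewrite big_nil; split=> // _ h; exact: h.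
rewrite big_cons; case: ifP => [Pi|nPi]; rewrite ?sat_And IH; split.
- by move=> [h1 h2] j; rewrite inE => /orP[/eqP -> //|]; apply: h2.
- move=> h; split=> [|j jr]; first by apply: h; rewrite ?mem_head.
  by apply: h; rewrite inE jr orbT.
- by move=> h j; rewrite inE => /orP[/eqP ->|]; [rewrite nPi|apply: h].
- by move=> h j jr; apply: h; rewrite inE jr orbT.
Qed.

Lemma sat_bigOrP (F : frame) V (I : eqType) (r : seq I) (P : pred I)
    (f : I -> form) (x : F) :
  sat V (\big[Or/Bot]_(i <- r | P i) f i) x <->
  exists i, [/\ i \in r, P i & sat V (f i) x].
Proof.
elim: r => [|i r IH].
  by rewrite big_nil; split=> // -[j []].
rewrite big_cons; case: ifP => [Pi|nPi].
  rewrite sat_Or IH; split.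
    case=> [h|[j [jr Pj h]]]; first by exists i; rewrite mem_head.
    by exists j; rewrite inE jr orbT.
  case=> j []; rewrite inE => /orP[/eqP -> _ ?|jr Pj h]; first by left.
  by right; exists j.
rewrite IH; split=> -[j [jr Pj h]]; exists j; split=> //.
  by rewrite inE jr orbT.
by move: jr Pj; rewrite inE => /orP[/eqP -> |//]; rewrite nPi.
Qed.

Lemma sat_subst (F : frame) V s a :
  sat (F := F) V (subst s a) = sat (fun i => sat V (s i)) a.
Proof. by elim: a => //= [b -> c ->|b ->|b ->]. Qed.

Lemma tense_logic_Log (F : frame) : tense_logic (Log F).
Proof.
split.
- move=> a ta V x.
  suff E c : beval (fun d => `[<sat V d x>]) c <-> sat V c x by apply/E/ta.
  elim: c => //= [i|b IHb c IHc|b _|b _]; try exact: (iff_sym (rwP (asboolP _))).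
  split=> [/implyP h /IHb /h /IHc //|h]; by apply/implyP => /IHb /h /IHc.
- by move=> a b V x /= h1 h2 y xy; apply: h1 => //; apply: h2.
- move=> a b V x h1 h2 [y yx nb]; apply: h1; exists y => // ab.
  by apply: nb; apply: ab; apply: contrapT => na; apply: h2; exists y.
- by move=> a V x ax y xy; exists x.
- by move=> a V x ax [y yx] /=; apply=> h; apply: (h x).
- by move=> a b ab La V x; apply: (ab V x); apply: La.
- by move=> a La V x y _; apply: La.
- by move=> a La V x [y _]; apply; apply: La.
- by move=> s a La V x; rewrite sat_subst; apply: La.
Qed.

Lemma consistent_Log (F : frame) : consistent (Log F).
Proof. by have [x] := frame_inhabited F => /(_ (fun=> set0) x). Qed.

Fixpoint var_bound (a : form) : nat :=
  match a with
  | Var i => i.+1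
  | Bot => 0
  | Imp b c => maxn (var_bound b) (var_bound c)
  | Box b => var_bound b
  | Past b => var_bound b
  end.

(** Atoms are compared only for the first [q] variables, which allows a model with an infinite
    cluster to be matched with a finite one. *)
Lemma bisim_sat (F G : frame) (V : nat -> set F) (W : nat -> set G) q
    (Z : F -> G -> Prop) :
  (forall i x y, i < q -> Z x y -> (V i x <-> W i y)) ->
  (forall x y x', Z x y -> acc x x' -> exists2 y', acc y y' & Z x' y') ->
  (forall x y y', Z x y -> acc y y' -> exists2 x', acc x x' & Z x' y') ->
  (forall x y x', Z x y -> acc x' x -> exists2 y', acc y' y & Z x' y') ->
  (forall x y y', Z x y -> acc y' y -> exists2 x', acc x' x & Z x' y') ->
  forall a, var_bound a <= q ->
  forall x y, Z x y -> (sat V a x <-> sat W a y).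
Proof.
move=> Zv Zf Zb Zpf Zpb; elim=> [i|//|b IHb c IHc|b IHb|b IHb] /=.
- by move=> ? x y; apply: Zv.
- rewrite geq_max => /andP[bq cq] x y xy.
  by rewrite (IHb bq x y xy) (IHc cq x y xy).
- move=> bq x y xy; split=> h.
    by move=> y' /(Zb _ _ _ xy)[x' xx' x'y']; apply/(IHb bq x' y' x'y')/h.
  by move=> x' /(Zf _ _ _ xy)[y' yy' x'y']; apply/(IHb bq x' y' x'y')/h.
- move=> bq x y xy; split.
    move=> [x' /(Zpf _ _ _ xy)[y' yy' x'y'] h].
    by exists y' => //; apply/(IHb bq x' y' x'y').
  move=> [y' /(Zpb _ _ _ xy)[x' yy' x'y'] h].
  by exists x' => //; apply/(IHb bq x' y' x'y').
Qed.

Lemma sat_agree (F : frame) (V W : nat -> set F) q a x :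
  var_bound a <= q -> (forall i, i < q -> V i = W i) ->
  sat V a x <-> sat W a x.
Proof.
move=> aq VW; apply: (@bisim_sat _ _ V W q (@eq F)) => //.
- by move=> i y _ iq <-; rewrite VW.
- by move=> y _ y' <- ?; exists y'.
- by move=> y _ y' <- ?; exists y'.
- by move=> y _ y' <- ?; exists y'.
- by move=> y _ y' <- ?; exists y'.
Qed.

(** * t-morphisms *)

Lemma t_morphismP (F G : frame) (f : F -> G) :
  (forall y z, acc y z -> acc (f y) (f z)) ->
  (forall y w, acc (f y) w -> exists2 z, acc y z & f z = w) ->
  (forall y w, acc w (f y) -> exists2 z, acc z y & f z = w) ->
  t_morphism f.
Proof.
move=> hf hs hp y; split; apply/seteqP; split=> w.
- by move=> [z yz <-]; apply: hf.
- by move=> /hs[z yz <-]; exists z.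
- by move=> [z yz <-]; apply: hf.
- by move=> /hp[z yz <-]; exists z.
Qed.

Section TMorphism.
Variables (F G : frame) (f : F -> G).
Hypothesis tf : t_morphism f.

Lemma tm_acc y z : acc y z -> acc (f y) (f z).
Proof.
move=> yz; have [h _] := tf y.
have : (f @` succs y) (f z) by exists z.
by rewrite h.
Qed.

Lemma tm_succ y w : acc (f y) w -> exists2 z, acc y z & f z = w.
Proof. by have [e _] := tf y; rewrite -[acc _ _]/(succs (f y) w) -e. Qed.

Lemma tm_pred y w : acc w (f y) -> exists2 z, acc z y & f z = w.
Proof. by have [_ e] := tf y; rewrite -[acc _ _]/(preds (f y) w) -e. Qed.

Lemma tm_sat (V : nat -> set G) a y :
  sat (fun i => f @^-1` V i) a y <-> sat V a (f y).
Proof.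
apply: (bisim_sat (q := var_bound a) (Z := fun y w => f y = w)) => //.
- by move=> i x _ _ <-.
- by move=> x _ x' <- /tm_acc; exists (f x').
- by move=> x _ w <- /tm_succ.
- by move=> x _ x' <- /tm_acc; exists (f x').
- by move=> x _ w <- /tm_pred.
Qed.

Hypothesis sf : range f = setT.

Lemma tm_surj w : exists y, f y = w.
Proof. have [y _ <-] : range f w by rewrite sf. by exists y. Qed.

Lemma tm_Log : Log F `<=` Log G.
Proof. by move=> a h V w; have [y <-] := tm_surj w; apply/tm_sat/h. Qed.

Lemma tm_rooted : rooted F -> rooted G.
Proof.
move=> [r hr]; exists (f r) => w; have [y <-] := tm_surj w.
elim: {y}(hr y) => [y z /tm_acc ?|y|y z _ ?|y z t _ ? _ ?].
- exact: rst_step.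
- exact: rst_refl.
- exact: rst_sym.
- exact: rst_trans (f z) _ _ _.
Qed.

End TMorphism.

Lemma t_morphism_comp (F G H : frame) (f : F -> G) (g : G -> H) :
  t_morphism f -> t_morphism g -> t_morphism (g \o f).
Proof.
move=> tf tg; apply: t_morphismP => [y z /(tm_acc tf)/(tm_acc tg) //|y w|y w].
- by move=> /(tm_succ tg)[v /(tm_succ tf)[z yz <-] <-]; exists z.
- by move=> /(tm_pred tg)[v /(tm_pred tf)[z yz <-] <-]; exists z.
Qed.

Lemma surj_range (A B : Type) (f : A -> B) :
  (forall w, exists y, f y = w) -> range f = setT.
Proof. by move=> h; apply/seteqP; split=> // w _; have [y <-] := h w; exists y. Qed.

Lemma range_compT (F G H : Type) (f : F -> G) (g : G -> H) :
  range f = setT -> range g = setT -> range (g \o f) = setT.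
Proof.
move=> sf sg; apply: surj_range => w.
have [v _ <-] : range g w by rewrite sg.
have [y _ <-] : range f v by rewrite sf.
by exists y.
Qed.

(** Both relations are pulled back from one [R], so any preimage of the target, as supplied by
    surjectivity, satisfies the back conditions. *)
Lemma pullback_t_morphism (S : Type) (R : S -> S -> Prop) (F G : frame)
    (p : F -> S) (p' : G -> S) (g : F -> G) :
  (forall y z, acc y z <-> R (p y) (p z)) ->
  (forall y z, acc y z <-> R (p' y) (p' z)) ->
  (forall y, p' (g y) = p y) -> range g = setT -> t_morphism g.
Proof.
move=> hp hp' gp sg; apply: t_morphismP.
- by move=> y z /hp; rewrite -!gp => /hp'.
- move=> y w; have [z _ <-] : range g w by rewrite sg.
  by move=> /hp'; rewrite !gp => /hp; exists z.
- move=> y w; have [z _ <-] : range g w by rewrite sg.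
  by move=> /hp'; rewrite !gp => /hp; exists z.
Qed.

Lemma isomorphic_TM (F G : frame) :
  isomorphic F G -> exists2 f : F -> G, t_morphism f & range f = setT.
Proof.
move=> [f [g fK gK] hf].
have sf : range f = setT by apply: surj_range => w; exists (g w); rewrite gK.
exists f => //; exact: (pullback_t_morphism (p := f) (p' := id)).
Qed.

(** * Preorders of bounded depth, width and diameter *)

Definition equi (T : Type) (R : T -> T -> Prop) (x y : T) := R x y /\ R y x.

Definition converse (T : Type) (R : T -> T -> Prop) (x y : T) := R y x.

(* [depth R j x]: every strict R-chain starting at x has at most j points. *)
Fixpoint depth (T : Type) (R : T -> T -> Prop) (j : nat) (x : T) : Prop :=
  match j with
  | 0 => False
  | i.+1 => forall y, R x y -> ~ R y x -> depth R i y
  end.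

Definition width (T : Type) (R : T -> T -> Prop) (n : nat) (P : set T) :=
  forall f : nat -> T, (forall i, i <= n -> P (f i)) ->
  exists i j, [/\ i <= n, j <= n, i <> j & R (f i) (f j)].

(** A strict chain going down, read backwards, is a strict chain going up. *)
Lemma depth_converse (T : Type) (R : T -> T -> Prop) k :
  (forall x, depth R k x) -> forall x, depth (converse R) k x.
Proof.
move=> h x; apply: contrapT => nx.
(* Walking down a chain from [x], each strict step adds one to the depth bound [i] that the current
   point is known to violate. *)
suff [y] : exists y, ~ depth R (0 + k) y by apply; apply: h.
have : ~ depth R 0 x by [].
elim: k x 0 nx {h} => [|k IH] x i nx ni; first by exists x; rewrite addn0.
have [y [xy yx ny]] : exists y, [/\ R y x, ~ R x y & ~ depth (converse R) k y].
  apply: contrapT => n; apply: nx => y xy yx; apply: contrapT => ny.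
  by apply: n; exists y.
rewrite -addSnnS; apply: (IH y) => // h.
exact/ni/h.
Qed.

(** The depth bound is the induction measure: move to a strict successor in [P] as long as there is
    one. *)
Lemma depth_maximal (T : Type) (R : T -> T -> Prop) (P : set T) k x :
  (forall x, R x x) -> (forall x y z, R x y -> R y z -> R x z) ->
  depth R k x -> P x ->
  exists y, [/\ R x y, P y & forall z, R y z -> P z -> R z y].
Proof.
move=> rR tR; elim: k x => [//|k IH] x dx Px.
have [h|] := pselect (forall z, R x z -> P z -> R z x); first by exists x.
move=> /existsNP[z /not_implyP[xz /not_implyP[Pz zx]]].
have [y [zy Py hy]] := IH z (dx z xz zx) Pz.
by exists y; split=> //; apply: tR zy.
Qed.

(** Greedy choice: once [q] is picked, the points of [Q] unrelated to [q] have width one less,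
    because [q] could be added to any family violating that bound. *)
Lemma antichain_cover (T : eqType) (E : T -> T -> Prop) (n : nat) (Q : set T) :
  (forall x, E x x) -> (forall x y, E x y -> E y x) -> width E n Q ->
  exists s : seq T, size s <= n /\ forall x, Q x -> exists2 w, w \in s & E x w.
Proof.
move=> rE sE; elim: n Q => [|n IH] Q hQ.
  exists [::]; split=> // x Qx; have [//|i [j []]] := hQ (fun=> x).
  by rewrite !leqn0 => /eqP -> /eqP ->.
have [[q Qq]|nQ] := pselect (exists q, Q q); last first.
  by exists [::]; split=> // x Qx; case: nQ; exists x.
have [|s [sn hs]] := IH [set x | Q x /\ ~ E x q].
  move=> f Qf; pose g i := if i is i'.+1 then f i' else q.
  have [|i [j [ilt jlt ij Eg]]] := hQ g.
    by case=> [//|i] /Qf [].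
  case: i j ilt jlt ij Eg => [|i] [|j] //= ilt jlt ij Eg.
  - by case: (Qf _ jlt) => _; case; apply: sE.
  - by case: (Qf _ ilt).
  - by exists i, j; split=> // e; apply: ij; rewrite e.
exists (q :: s); split=> // x Qx.
have [xq|nxq] := pselect (E x q); first by exists q; rewrite ?mem_head.
by have [//|w ws xw] := hs x; exists w; rewrite // inE ws orbT.
Qed.

(** Points are sorted by exact depth. Comparable points of the same exact depth are equivalent, so
    each layer of [P] needs at most [n] representatives. *)
Lemma depth_cover (T : eqType) (R : T -> T -> Prop) (n k : nat) (P : set T) :
  (forall x, R x x) -> width R n P -> exists s : seq T, size s <= n * k /\
    forall x, P x -> depth R k x -> exists2 w, w \in s & equi R x w.
Proof.
move=> rR hP; elim: k => [|k [s [sn hs]]]; first by exists [::].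
have [] := @antichain_cover T (equi R) n
  [set x | [/\ P x, depth R k.+1 x & ~ depth R k x]] => //.
- by move=> x y [].
- move=> f Pf; have [i|i [j [il jl ij Rij]]] := hP f; first by move=> /Pf[].
  exists i, j; split=> //; split=> //; apply: contrapT => nji.
  have [_ di _] := Pf i il; have [_ _] := Pf j jl; apply; exact: di.
- move=> t [tn ht]; exists (t ++ s); rewrite size_cat mulnS leq_add //.
  split=> // x Px dx; have [dkx|ndkx] := pselect (depth R k x).
    by have [w ws ?] := hs x Px dkx; exists w; rewrite // mem_cat ws orbT.
  by have [//|w wt ?] := ht x; exists w; rewrite // mem_cat wt.
Qed.

(** * Zigzag paths *)

Definition zigzag (T : Type) (R : T -> T -> Prop) (x y : T) := R x y \/ R y x.

(** Paths of exactly [j] steps, which for reflexive [R] means at most [j]; this interprets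
    [iter j Delta]. *)
Fixpoint reach (T : Type) (R : T -> T -> Prop) (j : nat) (x y : T) : Prop :=
  match j with
  | 0 => x = y
  | i.+1 => exists2 z, zigzag R x z & reach R i z y
  end.

Section Reach.
Variables (T : Type) (R : T -> T -> Prop).
Hypothesis rR : forall x, R x x.
Hypothesis tR : forall x y z, R x y -> R y z -> R x z.

Lemma reach_cat i j x y z : reach R i x y -> reach R j y z -> reach R (i + j) x z.
Proof. by elim: i x => [|i IH] x /= => [-> //|[w xw /IH h /h]]; exists w. Qed.

Lemma reach1 x y : zigzag R x y -> reach R 1 x y.
Proof. by exists y. Qed.

Lemma reach_sym i x y : reach R i x y -> reach R i y x.
Proof.
elim: i x => [|i IH] x //= [z xz /IH zy].
rewrite -/(reach R i.+1 y x) -addn1; apply: reach_cat zy _.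
by apply: reach1; case: xz; [right|left].
Qed.

Lemma reach_leq i j x y : i <= j -> reach R i x y -> reach R j x y.
Proof.
move=> /subnK <-; elim: (j - i) => [//|d IH] h.
by exists x; [left|apply: IH].
Qed.

Lemma zigzag_equi x y z : equi R x y -> zigzag R y z -> zigzag R x z.
Proof. by move=> [xy yx] [yz|zy]; [left|right]; apply: tR; eassumption. Qed.

Lemma reach_equil i x x' y : 0 < i -> equi R x' x -> reach R i x y -> reach R i x' y.
Proof. by case: i => [//|i] _ xx' [z xz zy]; exists z => //; apply: zigzag_equi xz. Qed.

Lemma reach_equir i x y y' : 0 < i -> equi R y' y -> reach R i x y -> reach R i x y'.
Proof. by move=> i0 yy' /reach_sym /(reach_equil i0 yy') /reach_sym. Qed.

Lemma clos_reach x y : clos_refl_sym_trans T R x y -> exists i, reach R i x y.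
Proof.
elim=> {x y} [x y xy|x|x y _ [i] /reach_sym h|x y z _ [i hi] _ [j hj]].
- by exists 1; apply: reach1; left.
- by exists 0.
- by exists i.
- by exists (i + j); apply: reach_cat hj.
Qed.

End Reach.

(** After its first step a path can be restarted at the representative of the cluster it has
    entered, so each step multiplies the bound by [B]. *)
Lemma reach_cover (T : eqType) (R : T -> T -> Prop) (B : nat) :
  (forall x, R x x) -> (forall x y z, R x y -> R y z -> R x z) ->
  (forall x, exists s : seq T, size s <= B /\
     forall y, zigzag R x y -> exists2 w, w \in s & equi R y w) ->
  forall j x, exists s : seq T, size s <= B ^ j /\
    forall y, reach R j x y -> exists2 w, w \in s & equi R y w.
Proof.
move=> rR tR hB; elim=> [|j IH] x.
  by exists [:: x]; split=> // y <-; exists x; rewrite ?mem_head.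
have [s [sB hs]] := hB x; have [t ht] := choice IH.
exists (flatten [seq t z | z <- s]); split.
  rewrite expnS (leq_trans _ (leq_mul sB (leqnn _))) //.
  elim: s {sB hs} => [//|z s IHs] /=.
  by rewrite size_cat mulSn leq_add // (ht z).1.
move=> y [z /hs [w ws zw] zy].
(* Only a path of positive length can have its start moved within a cluster; for length 0 the end
   moves to [w] as well. *)
have [y' yy' /(ht w).2[v vt y'v]] : exists2 y', equi R y y' & reach R j w y'.
  case: j zy {ht IH t} => [<-|j zy]; first by exists w.
  by exists y; [split; exact: rR|apply: (@reach_equil _ _ tR j.+1 z w y) => //; case: zw].
exists v; first by apply/flatten_mapP; exists w.
by split; [apply: tR y'v.1; case: yy'|apply: tR y'v.2 _; case: yy'].
Qed.

(** * General frames *)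

(** The admissible sets of a general frame. Bounds proved in this generality apply both to the
    canonical frame with its definable sets and to an ordinary frame with all sets. *)
Record algebra (F : frame) (A : set (set F)) : Prop := {
  alg0 : A set0;
  alg_imp : forall a b, A a -> A b -> A [set x | a x -> b x];
  alg_box : forall a, A a -> A [set x | forall y, succs x y -> a y];
  alg_past : forall a, A a -> A [set x | exists2 y, preds x y & a y]
}.

Definition valid (F : frame) (A : set (set F)) (a : form) : Prop :=
  forall V, (forall i, A (V i)) -> forall x, sat V a x.

Definition tight (F : frame) (A : set (set F)) : Prop :=
  forall x y : F, ~ acc x y -> exists2 a, A a & (forall z, acc x z -> a z) /\ ~ a y.

Lemma algebra_setT (F : frame) : algebra [set: set F].
Proof. by []. Qed.

Lemma tight_setT (F : frame) : tight [set: set F].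
Proof. by move=> x y nxy; exists [set z | acc x z]. Qed.

Section Algebra.
Variables (F : frame) (A : set (set F)).
Hypothesis algA : algebra A.

Lemma algC a : A a -> A (~` a).
Proof. by move=> Aa; apply: (alg_imp algA Aa (alg0 algA)). Qed.

Lemma algT : A setT.
Proof. by have := algC (alg0 algA); rewrite setC0. Qed.

Lemma algI a b : A a -> A b -> A (a `&` b).
Proof.
move=> Aa Ab; rewrite -(setCK (a `&` b)); apply: algC.
suff -> : ~` (a `&` b) = [set x | a x -> (~` b) x] by apply: alg_imp (algC Ab).
by apply/seteqP; split=> x /= h; [move=> ax bx; apply: h|case=> ax; apply: h].
Qed.

Lemma alg_all (I : eqType) (r : seq I) (Q : I -> set F) :
  (forall i, i \in r -> A (Q i)) -> A [set x | forall i, i \in r -> Q i x].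
Proof.
elim: r => [|i r IH] hQ.
  by have -> : [set x | forall i, i \in [::] -> Q i x] = setT; [apply/seteqP|exact: algT].
suff -> : [set x | forall j, j \in i :: r -> Q j x] =
    Q i `&` [set x | forall i, i \in r -> Q i x].
  apply: algI; first by apply: hQ; rewrite mem_head.
  by apply: IH => j jr; apply: hQ; rewrite inE jr orbT.
apply/seteqP; split=> x /= h.
  by split=> [|j jr]; apply: h; [rewrite mem_head|rewrite inE jr orbT].
by case: h => h1 h2 j; rewrite inE => /orP[/eqP -> //|]; apply: h2.
Qed.

(** * Conditions forced by the axioms on tight general frames *)

Hypothesis tA : tight A.

Definition upd (V : nat -> set F) (j : nat) (a : set F) : nat -> set F :=
  fun i => if i == j then a else V i.

Lemma alg_upd V j a : (forall i, A (V i)) -> A a -> forall i, A (upd V j a i).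
Proof. by move=> hV Aa i; rewrite /upd; case: eqP. Qed.

Lemma var_bound_bd k : var_bound (bd k) <= k.
Proof.
case: k => [//|k]; elim: k => [//|k IH].
rewrite -[bd k.+2]/(Imp (Dia (And (Box (Var k.+1)) (Neg (bd k.+1)))) (Var k.+1)) /=.
by rewrite !geq_max !leqnn (leq_trans IH).
Qed.

(** A strict step from [x] to [y] yields an admissible set that contains all successors of [y] but
    not [x]. It interprets the outermost variable; the induction hypothesis at [y] interprets the
    others. *)
Lemma refute_bd k (x : F) : ~ depth (@acc F) k.+1 x ->
  exists2 V, forall i, A (V i) & ~ sat V (bd k.+1) x.
Proof.
elim: k x => [|k IH] x nx.
  have [y [xy yx]] : exists y, acc x y /\ ~ acc y x.
    by apply: contrapT => n; apply: nx => y xy yx; case: n; exists y.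
  have [a Aa [ya nax]] := tA yx.
  exists (fun=> a) => //= h; apply/nax/h => n.
  exact: (n y).
have [y [xy yx ny]] : exists y, [/\ acc x y, ~ acc y x & ~ depth (@acc F) k.+1 y].
  apply: contrapT => n; apply: nx => y xy yx; apply: contrapT => ny.
  by apply: n; exists y.
have [a Aa [ya nax]] := tA yx.
have [V AV nV] := IH y ny.
exists (upd V k.+1 a); first exact: alg_upd.
rewrite -[bd k.+2]/(Imp (Dia (And (Box (Var k.+1)) (Neg (bd k.+1)))) (Var k.+1)).
move=> /sat_Imp h; apply: nax.
suff : sat (upd V k.+1 a) (Var k.+1) x by rewrite /= /upd eqxx.
apply/h/sat_Dia; exists y => //; apply/sat_And; split.
  by move=> z yz; rewrite /= /upd eqxx; apply: ya.
apply/sat_Neg => h'; apply: nV.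
(* The variable with index [k.+1] does not occur in [bd k.+1], so the update keeps that formula
   refuted at [y]. *)
have [|_] := @sat_agree F V (upd V k.+1 a) k.+1 _ y (var_bound_bd k.+1); last exact.
by move=> i; rewrite /upd; case: ltngtP.
Qed.

Lemma valid_bd k : 0 < k -> valid A (bd k) -> forall x : F, depth (@acc F) k x.
Proof.
case: k => [//|k] _ h x; apply: contrapT => /refute_bd[V AV]; apply.
exact: h.
Qed.

(** If the points [y i] were pairwise incomparable, tightness would give them admissible
    neighbourhoods such that no point of one is related to a point of another, which refutes the
    axiom. As this is symmetric, one proof serves [Dia] and [Past]. *)
Lemma valid_bw (D : form -> form) (R : F -> F -> Prop) n :
  (forall V a x, sat V (D a) x <-> exists2 y, R x y & sat V a y) ->
  R = @acc F \/ R = converse (@acc F) ->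
  valid A (bw D n) -> forall x, width R n [set y | R x y].
Proof.
move=> hD hR vA x y xy.
suff [i [j [ilt jlt ij yij]]] :
    exists i j, [/\ i <= n, j <= n, i <> j & acc (y i) (y j)].
  case: hR => ->; first by exists i, j.
  by exists j, i; split=> // e; apply: ij.
apply: contrapT => ny.
have hc (p : 'I_n.+1 * 'I_n.+1) : exists a, p.1 != p.2 ->
    [/\ A a, forall z, acc (y p.1) z -> a z & ~ a (y p.2)].
  case: p => i j /=; have [<-|ij] := eqVneq i j; first by exists setT.
  have [|a Aa [ya nya]] := @tA (y i) (y j); last by exists a.
  move=> yij; apply: ny; exists i, j; split=> //.
  - by rewrite -ltnS.
  - by rewrite -ltnS.
  - by move=> e; case/eqP: ij; apply: val_inj.
have [c {}hc] := choice hc.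
(* All successors of a point of [V i] lie in [c (i, j)], while points of [V j] avoid [c (i, j)]. The
   default of [inord] only affects variables beyond index [n]. *)
pose Q (i j : 'I_n.+1) : set F := [set z | i != j ->
  (forall t, acc z t -> c (i, j) t) /\ ~ c (j, i) z].
pose V i : set F := [set z | forall j, j \in enum 'I_n.+1 -> Q (inord i) j z].
have AV i : A (V i).
  apply: alg_all => j _; have [e|ij] := eqVneq (inord i) j.
    suff -> : Q (inord i) j = setT by exact: algT.
    by apply/seteqP; split=> // z _; rewrite /Q /= e eqxx.
  suff -> : Q (inord i) j =
    [set z | forall t, succs z t -> c (inord i, j) t] `&` ~` c (j, inord i).
    apply: algI; first by apply: alg_box => //; case: (hc (inord i, j)).
    by apply: algC; case: (hc (j, inord i)); rewrite //= eq_sym.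
  by apply/seteqP; split=> z; rewrite /Q /= ?ij; [apply|].
have Vy (i : 'I_n.+1) : V i (y i).
  move=> j _; rewrite inord_val => ij; split.
    by case: (hc (i, j)).
  by case: (hc (j, i)); rewrite //= eq_sym.
have sep (i j : 'I_n.+1) z t : i != j -> V i z -> V j t -> ~ acc z t.
  move=> ij /(_ j (mem_enum _ _)); rewrite inord_val => /(_ ij)[h _].
  move=> /(_ i (mem_enum _ _)); rewrite inord_val.
  by rewrite eq_sym in ij => /(_ ij)[_ h'] zt; apply/h'/h.
have /sat_Imp h := vA V AV x.
have {}/h : sat V (\big[And/Top]_(i < n.+1) D (Var i)) x.
  apply/sat_bigAndP => i _ _; apply/hD; exists (y i); last exact: Vy.
  by apply: xy; rewrite -ltnS.
move=> /sat_bigOrP[i [_ _ /sat_bigOrP[j [_ ij /hD[z xz /sat_And[zi]]]]]].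
move=> /sat_Or[zj|/hD[t zt tj]]; first exact: (sep i j z z ij zi zj (acc_refl z)).
move: zt; case: hR => -> zt; first exact: (sep i j z t).
by apply: (sep j i t z) => //; rewrite eq_sym.
Qed.

Lemma sat_Delta V a (x : F) :
  sat V (Delta a) x <-> exists2 y, zigzag (@acc F) x y & sat V a y.
Proof.
rewrite /Delta !sat_Or; split.
- case=> [ax|[/sat_Dia[y xy ay]|[y yx ay]]].
  + by exists x => //; left; apply: acc_refl.
  + by exists y => //; left.
  + by exists y => //; right.
- move=> [y [xy|yx] ay]; right; first by left; apply/sat_Dia; exists y.
  by right; exists y.
Qed.

Lemma sat_iter_Delta V j a (x : F) :
  sat V (iter j Delta a) x <-> exists2 y, reach (@acc F) j x y & sat V a y.
Proof.
elim: j x => [|j IH] x.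
  by rewrite /=; split=> [?|[_ <-]//]; exists x.
rewrite iterS sat_Delta; split.
  by move=> [y xy /IH [z yz az]]; exists z => //; exists y.
by move=> [z [y xy yz] az]; exists y => //; apply/IH; exists z.
Qed.

(** Finitely many clusters are reachable in [l] steps, so a finite intersection of admissible sets
    contains [y] and meets that region at most in the cluster of [y]. The axiom then provides a
    point of this cluster within [l] steps. *)
Lemma valid_bz (l : nat) : 0 < l -> valid A (bz l) ->
  forall x y (s : seq {classic F}),
  (forall z, reach (@acc F) l x z -> exists2 w, w \in s & equi (@acc F) z w) ->
  reach (@acc F) l.+1 x y -> reach (@acc F) l x y.
Proof.
move=> l0 vA x y s hs xy; apply: contrapT => nxy.
have tr := @acc_trans F.
have hc (w : F) : exists Qw : set F, [/\ A Qw, Qw y &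
    ~ equi (@acc F) w y -> forall z, equi (@acc F) z w -> ~ Qw z].
  have [yw|nyw] := pselect (acc y w).
    have [wy|nwy] := pselect (acc w y);
      first by exists setT; split; [exact: algT|by []|case].
    have [a Aa [wa nay]] := tA nwy; exists (~` a); split=> //; first exact: algC.
    by move=> _ z [zw wz]; apply; apply: wa.
  have [a Aa [ya naw]] := tA nyw.
  exists [set z | forall t, succs z t -> a t]; split=> //; first exact: alg_box.
  by move=> _ z [zw wz] h; apply/naw/h.
have [Q hQ] := choice hc.
pose V (i : nat) : set F := [set z | forall w : {classic F}, w \in s -> Q w z].
have AV i : A (V i) by apply: alg_all => w _; case: (hQ w).
have /sat_Imp h := vA V AV x.
have {}/h/sat_iter_Delta : sat V (iter l.+1 Delta (Var 0)) x.
  by apply/sat_iter_Delta; exists y => // w _; case: (hQ w).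
move=> [z xz]; have /hs[w ws zw] := xz; move=> /(_ w ws).
have [_ _ h] := hQ w; have [wy|nwy] := pselect (equi (@acc F) w y); last exact: h.
move=> _; apply: nxy; apply: (reach_equir _ l0 _ xz) => //.
by case: zw wy => [zw wz] [wy yw]; split; [apply: tr wz|apply: tr wy].
Qed.

End Algebra.

(** At most [n * k] clusters lie above a point and at most [m * k] below it, and [l] zigzag steps
    reach everything. *)
Definition cluster_bound (k l n m : nat) := (n * k + m * k) ^ l.

Section Bounds.
Variables (F : frame) (A : set (set F)) (k l n m : nat).
Hypotheses (algA : algebra A) (tA : tight A).
Hypotheses (k0 : 0 < k) (l0 : 0 < l).
Hypotheses (vbd : valid A (bd k)) (vbz : valid A (bz l)).
Hypotheses (vbwp : valid A (bw_plus n)) (vbwm : valid A (bw_minus m)).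

Let R := @acc F.

Lemma zigzag_cover (x : F) : exists s : seq {classic F}, size s <= n * k + m * k /\
  forall y, zigzag R x y -> exists2 w, w \in s & equi R y w.
Proof.
have dk := valid_bd tA k0 vbd.
have dk' := depth_converse dk.
have [s [sn hs]] := @depth_cover {classic F} R n k _ (@acc_refl F)
  (valid_bw algA tA (@sat_Dia F) (or_introl erefl) vbwp (x := x)).
have [t [tn ht]] := @depth_cover {classic F} (converse R) m k _ (@acc_refl F)
  (valid_bw (R := converse R) algA tA (@sat_Past F) (or_intror erefl) vbwm (x := x)).
exists (s ++ t); rewrite size_cat leq_add //; split=> // y [xy|yx].
  by have [w ws ?] := hs y xy (dk y); exists w; rewrite // mem_cat ws.
have [w wt []] := ht y yx (dk' y); exists w; first by rewrite mem_cat wt orbT.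
by split.
Qed.

(** A path of any length is shortened repeatedly from [l.+1] steps to [l] by [valid_bz]; the finite
    cover this requires comes from [reach_cover]. *)
Lemma reach_all (x y : F) : rooted F -> reach R l x y.
Proof.
move=> [r hr]; have tr := @acc_trans F.
have cov := reach_cover (@acc_refl F : forall x : {classic F}, _) tr zigzag_cover.
have [i] : exists i, reach R i x y.
  by apply: clos_reach => //; apply: rst_trans (hr y); apply: rst_sym.
elim: i x => [|i IH] x h; first exact: (reach_leq (@acc_refl F) _ h).
have [s [_ hs]] := cov l x; apply: (valid_bz algA tA l0 vbz hs).
by case: h => z xz /IH; exists z.
Qed.

Lemma clusters_cover : rooted F ->
  exists s : seq {classic F}, size s <= cluster_bound k l n m /\
    forall y : F, exists2 w, w \in s & equi R y w.
Proof.
move=> rF; have [r _] := rF.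
have [s [ss hs]] := reach_cover (@acc_refl F : forall x : {classic F}, _)
  (@acc_trans F) zigzag_cover l r.
by exists s; split=> // y; apply/hs/reach_all.
Qed.

End Bounds.

(** * Subframes generated by a point in both directions *)

Section Generated.
Variables (F : frame) (r : F).

Definition gen_carrier := {y : F | clos_refl_sym_trans F (@acc F) r y}.

Definition gen_acc (x y : gen_carrier) := acc (sval x) (sval y).

Definition gen_root : gen_carrier := exist _ r (rst_refl _ _ r).

Definition gen : frame :=
  @Frame gen_carrier gen_acc (inhabits gen_root) (fun x => acc_refl (sval x))
    (fun x y z => @acc_trans F (sval x) (sval y) (sval z)).

Lemma rooted_gen : rooted gen.
Proof.
exists gen_root => -[y ry].
suff [h] : exists h, clos_refl_sym_trans gen (@acc gen) gen_root (exist _ y h).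
  by rewrite (Prop_irrelevance ry h).
(* Paths grow at their far end, so each prefix certifies that its last point lies in the carrier. *)
have /clos_rst_rstn1_iff := ry; elim=> {y ry} [|y z yz _ [h hy]].
  by exists (rst_refl _ _ r); apply: rst_refl.
have hz : clos_refl_sym_trans F (@acc F) r z.
  by apply: rst_trans (h) _; case: yz => ?; [apply: rst_step|apply/rst_sym/rst_step].
exists hz; apply: rst_trans hy _.
by case: yz => ?; [apply: rst_step|apply/rst_sym/rst_step].
Qed.

Lemma gen_t_morphism : t_morphism (sval : gen -> F).
Proof.
apply: t_morphismP => // [[y ry] z yz|[y ry] z zy] /=.
  by exists (exist _ z (rst_trans _ _ _ _ _ ry (rst_step _ _ _ _ yz))).
by exists (exist _ z (rst_trans _ _ _ _ _ ry (rst_sym _ _ _ _ (rst_step _ _ _ _ zy)))).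
Qed.

Definition gen_restrict (A : set (set F)) : set (set gen) :=
  [set a | exists2 b, A b & a = sval @^-1` b].

Lemma algebra_restrict A : algebra A -> algebra (gen_restrict A).
Proof.
move=> algA; split.
- by exists set0; [exact: alg0|].
- move=> _ _ [b Ab ->] [c Ac ->]; exists [set x | b x -> c x] => //.
  exact: alg_imp.
- move=> _ [b Ab ->]; exists [set x | forall y, succs x y -> b y].
    exact: alg_box.
  apply/seteqP; split=> x h y xy; last exact: (h (sval y)).
  by have [z xz <-] := tm_succ gen_t_morphism xy; apply: h.
- move=> _ [b Ab ->]; exists [set x | exists2 y, preds x y & b y].
    exact: alg_past.
  apply/seteqP; split=> x [y yx h]; first by exists (sval y).
  by have [z xz e] := tm_pred gen_t_morphism yx; exists z; rewrite //= e.
Qed.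

Lemma tight_restrict A : tight A -> tight (gen_restrict A).
Proof.
move=> tA x y /tA [a Aa [ha na]]; exists (sval @^-1` a); first by exists a.
by split=> // z; apply: ha.
Qed.

Lemma valid_restrict A a : valid A a -> valid (gen_restrict A) a.
Proof.
move=> vA V AV x; have hc i : exists b, A b /\ V i = sval @^-1` b.
  by have [b ? ?] := AV i; exists b.
have [b hb] := choice hc.
have -> : V = fun i => sval @^-1` b i by apply/funext => i; case: (hb i).
by apply/(tm_sat gen_t_morphism)/vA => i; case: (hb i).
Qed.

End Generated.

(** * Canonical frames and the finite model property *)

Ltac taut := let v := fresh "v" in move=> v /=;
  repeat match goal with
  | |- context [beval v ?a] => case: (beval v a)
  | |- context [v ?a] => case: (v a)
  end; done.

(* A set of theorems that need not be closed under substitution. *)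
Record theory (T : set form) : Prop := {
  th_taut : forall a, tautology a -> T a;
  th_K_box : forall a b, T (Imp (Box (Imp a b)) (Imp (Box a) (Box b)));
  th_K_pastbox : forall a b,
    T (Imp (PastBox (Imp a b)) (Imp (PastBox a) (PastBox b)));
  th_box_past : forall a, T (Imp a (Box (Past a)));
  th_pastbox_dia : forall a, T (Imp a (PastBox (Dia a)));
  th_mp : forall a b, T (Imp a b) -> T a -> T b;
  th_nec_box : forall a, T a -> T (Box a);
  th_nec_pastbox : forall a, T a -> T (PastBox a);
  th_box_refl : forall a, T (Imp (Box a) a);
  th_box_trans : forall a, T (Imp (Box a) (Box (Box a)));
  th_past_nn : forall a, T (Imp (Past a) (Past (Neg (Neg a))))
}.

Record th_filter (T G : set form) : Prop := {
  fi_sub : T `<=` G;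
  fi_mp : forall a b, G (Imp a b) -> G a -> G b;
  fi_con : ~ G Bot
}.

Record mcs (T G : set form) : Prop := {
  mcs_filter :> th_filter T G;
  mcs_max : forall a, G a \/ G (Neg a)
}.

Section Canonical.
Variable T : set form.
Hypothesis thT : theory T.

Lemma fi_taut G a b : th_filter T G -> tautology (Imp a b) -> G a -> G b.
Proof. by move=> fG /(th_taut thT)/(fi_sub fG); apply: (fi_mp fG). Qed.

Lemma th_taut1 a b : tautology (Imp a b) -> T a -> T b.
Proof. by move=> /(th_taut thT); apply: th_mp. Qed.

Lemma filter_chain (C : set (set form)) : C `<=` th_filter T -> total_on C subset ->
  C !=set0 -> th_filter T (\bigcup_(X in C) X).
Proof.
move=> CF tot [X CX]; split.
- by move=> a /(fi_sub (CF _ CX)); exists X.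
- move=> a b [Y CY Yab] [Z CZ Za]; have [YZ|ZY] := tot _ _ CY CZ.
    by exists Z => //; apply: fi_mp (CF _ CZ) _ _ (YZ _ Yab) Za.
  by exists Y => //; apply: fi_mp (CF _ CY) _ _ Yab (ZY _ Za).
- by move=> [Y /CF fY]; apply: fi_con fY.
Qed.

Lemma lindenbaum G : th_filter T G -> exists2 D, mcs T D & G `<=` D.
Proof.
(* The empty set is included because the union of the empty chain has to belong to [P]. *)
move=> fG; pose P := [set X | X = set0 \/ th_filter T X /\ G `<=` X].
have [|D [PD maxD]] := @Zorn_bigcup form P.
  move=> C CP tot.
  have [[X CX X0]|n] := pselect (exists2 X, C X & X !=set0); last first.
    left; apply/seteqP; split=> // a [X CX Xa]; apply: n.
    by exists X => //; exists a.
  right; pose C' := C `&` [set Y | Y !=set0].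
  have hC' Y : C' Y -> th_filter T Y /\ G `<=` Y.
    by case=> /CP[-> [a]|].
  suff -> : \bigcup_(Y in C) Y = \bigcup_(Y in C') Y.
    split; last by move=> a Ga; exists X; [|apply: (hC' X _).2].
    apply: filter_chain; [by move=> Y /hC'[]| |by exists X].
    by move=> Y Z [CY _] [CZ _]; apply: tot.
  apply/seteqP; split=> a [Y CY Ya]; last by exists Y => //; case: CY.
  by exists Y => //; split=> //; exists a.
have {PD} [D0|[fD GD]] := PD.
  exfalso; apply: (maxD G); last by right; split=> // a.
  rewrite D0; split=> // h; apply: (h Top).
  exact/(fi_sub fG)/(th_taut thT).
exists D => //; split=> // a; apply: contrapT => /not_orP[na nna].
(* [X] is the filter obtained by adding [a] to [D]. It is consistent because [Neg a] is not in [D],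
   which contradicts maximality. *)
pose X := [set c | D (Imp a c)].
have DX : D `<=` X by move=> c; apply: (fi_taut fD); taut.
apply: (maxD X).
  by split=> // h; apply: na; apply: h; apply/(fi_sub fD)/(th_taut thT); taut.
right; split; last by move=> c /GD /DX.
split; [by move=> c /(fi_sub fD)/DX| |by []].
move=> c d h1 h2; apply: (fi_mp fD _ h2); apply: (fi_mp fD _ h1).
by apply/(fi_sub fD)/(th_taut thT); taut.
Qed.

Section Mcs.
Variable G : set form.
Hypothesis mG : mcs T G.

Lemma mcs_Neg a : G (Neg a) <-> ~ G a.
Proof.
split=> [na ga|na]; first exact: (fi_con mG (fi_mp mG na ga)).
by case: (mcs_max mG a).
Qed.

Lemma mcs_Imp a b : G (Imp a b) <-> (G a -> G b).
Proof.
split=> [ab|h]; first exact: (fi_mp mG ab).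
have [/h|] := mcs_max mG a; apply: (fi_taut mG); taut.
Qed.

Lemma mcs_mono_box a b : T (Imp a b) -> G (Box a) -> G (Box b).
Proof.
move=> /(th_nec_box thT)/(th_mp thT (th_K_box thT a b))/(fi_sub mG).
exact: (fi_mp mG).
Qed.

Lemma mcs_mono_pastbox a b : T (Imp a b) -> G (PastBox a) -> G (PastBox b).
Proof.
move=> /(th_nec_pastbox thT)/(th_mp thT (th_K_pastbox thT a b))/(fi_sub mG).
exact: (fi_mp mG).
Qed.

(** These are the formulas that [G] forces at every successor refuting [b]; inconsistency would give
    [Box b]. *)
Lemma mcs_box_filter b : ~ G (Box b) -> th_filter T [set c | G (Box (Imp (Neg b) c))].
Proof.
move=> nb; split.
- move=> c Tc; apply/(fi_sub mG)/(th_nec_box thT); apply: th_taut1 Tc; taut.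
- move=> c d /= h1 h2; apply: (fi_mp mG _ h2).
  apply: (fi_mp mG (fi_sub mG (th_K_box thT _ _))).
  apply: (mcs_mono_box _ h1); apply: (th_taut thT); taut.
- move=> h; apply: nb; apply: (mcs_mono_box _ h).
  apply: (th_taut thT); taut.
Qed.

Lemma mcs_past_filter b : G (Past b) -> th_filter T [set c | G (PastBox (Imp b c))].
Proof.
move=> hb; split.
- move=> c Tc; apply/(fi_sub mG)/(th_nec_pastbox thT); apply: th_taut1 Tc; taut.
- move=> c d /= h1 h2; apply: (fi_mp mG _ h2).
  apply: (fi_mp mG (fi_sub mG (th_K_pastbox thT _ _))).
  apply: (mcs_mono_pastbox _ h1); apply: (th_taut thT); taut.
(* [PastBox (Imp b Bot)] unfolds to [Neg (Past (Neg (Neg b)))], whence the double negation under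
   [Past]. *)
- move=> h; have := fi_mp mG (fi_sub mG (th_past_nn thT b)) hb.
  by apply/mcs_Neg.
Qed.

End Mcs.

Definition can_acc (G D : set form) : Prop := forall c, G (Box c) -> D c.

Lemma can_box G b : mcs T G -> (forall D, mcs T D -> can_acc G D -> D b) -> G (Box b).
Proof.
move=> mG h; apply: contrapT => nb.
have [D mD hD] := lindenbaum (mcs_box_filter mG nb).
have : D (Neg b) by apply/hD/(fi_sub mG)/(th_nec_box thT)/(th_taut thT); taut.
move=> /(mcs_Neg mD); apply; apply: h => // c Gc; apply: hD => /=.
by apply: (mcs_mono_box mG _ Gc); apply: (th_taut thT); taut.
Qed.

Lemma can_past G b : mcs T G -> G (Past b) ->
  exists D, [/\ mcs T D, can_acc D G & D b].
Proof.
move=> mG hb; have [D mD hD] := lindenbaum (mcs_past_filter mG hb).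
exists D; split=> //; last first.
  by apply/hD/(fi_sub mG)/(th_nec_pastbox thT)/(th_taut thT); taut.
(* [can_acc] speaks of [Box] only. If [Neg c] were in [G], the axiom linking past and future would
   put [Dia (Neg c)] into [D], against [Box c]. *)
move=> c Dc; apply: contrapT => /(mcs_Neg mG).
move=> /(fi_mp mG (fi_sub mG (th_pastbox_dia thT _))) h.
have : D (Dia (Neg c)).
  by apply: hD => /=; apply: (mcs_mono_pastbox mG _ h); apply: (th_taut thT); taut.
move=> /(mcs_Neg mD); apply; apply: (mcs_mono_box mD _ Dc); apply: (th_taut thT); taut.
Qed.

Lemma past_can G D b : mcs T G -> mcs T D -> can_acc D G -> D b -> G (Past b).
Proof.
move=> mG mD DG Db; apply: DG.
exact: (fi_mp mD (fi_sub mD (th_box_past thT b)) Db).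
Qed.

(* Not [set form]: its universe is too large for the carrier of a frame. *)
Definition can_carrier := {G : form -> Prop | mcs T G}.

Lemma can_refl (x : can_carrier) : can_acc (sval x) (sval x).
Proof.
case: x => G mG c /=; exact: (fi_mp mG (fi_sub mG (th_box_refl thT c))).
Qed.

Lemma can_trans (x y z : can_carrier) : can_acc (sval x) (sval y) ->
  can_acc (sval y) (sval z) -> can_acc (sval x) (sval z).
Proof.
case: x => G mG xy yz c /= Gc; apply/yz/xy.
exact: (fi_mp mG (fi_sub mG (th_box_trans thT c)) Gc).
Qed.

Definition can_frame (x : can_carrier) : frame :=
  Frame (inhabits x) can_refl can_trans.

Variable x0 : can_carrier.

(** The substitution [s] accounts for every admissible valuation, where each variable denotes the
    set defined by some formula. *)
Lemma canonical_truth (s : nat -> form) a (x : can_frame x0) :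
  sat (F := can_frame x0) (fun i => [set y | sval y (s i)]) a x <-> sval x (subst s a).
Proof.
elim: a x => [i|[G mG]|a IHa b IHb [G mG]|a IHa [G mG]|a IHa [G mG]].
- by [].
- by split=> // /(fi_con mG).
- by rewrite sat_Imp IHa IHb /= mcs_Imp.
- split=> [h|h [D mD] xy].
    apply: can_box => // D mD GD.
    by have /IHa := h (exist _ D mD) GD.
  exact/IHa/xy.
- split=> [[[D mD] DG /IHa h]|h]; first exact: past_can DG h.
  have [D [mD DG Da]] := can_past mG h.
  by exists (exist _ D mD); last apply/IHa.
Qed.

Definition definable : set (set (can_frame x0)) :=
  [set a | exists c, a = [set y | sval y c]].

Lemma algebra_definable : algebra definable.
Proof.
pose s (c : form) (i : nat) := c.
have h a d : [set y : can_frame x0 | sval y (subst d a)] =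
    sat (F := can_frame x0) (fun i => [set y | sval y (d i)]) a.
  by apply/seteqP; split=> x; rewrite /= canonical_truth.
split.
- by exists Bot; rewrite (h Bot Var).
- move=> _ _ [a ->] [b ->]; exists (Imp a b).
  by apply/seteqP; split=> -[G mG] /= /(mcs_Imp mG).
- by move=> _ [a ->]; exists (Box a); rewrite (h (Box (Var 0)) (s a)).
- by move=> _ [a ->]; exists (Past a); rewrite (h (Past (Var 0)) (s a)).
Qed.

Lemma tight_definable : tight definable.
Proof.
move=> [G mG] [D mD] /existsNP[c /not_implyP[Gc Dc]].
by exists [set y | sval y c]; [exists c|split=> // z; apply].
Qed.

Lemma valid_definable a : (forall s, T (subst s a)) -> valid definable a.
Proof.
move=> Ta V AV x; have [s hs] := choice AV.
have -> : V = fun i => [set y | sval y (s i)] by apply/funext.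
by apply/canonical_truth; case: x => G mG; apply: (fi_sub mG).
Qed.

End Canonical.

Lemma sval_inj (T : Type) (P : T -> Prop) : injective (@sval T P).
Proof.
by move=> [x hx] [y hy] /= e; subst y; rewrite (Prop_irrelevance hx hy).
Qed.

(** A cardinality bound by an enumeration that may repeat points. *)
Definition fin_cover (T : Type) (M : nat) : Prop :=
  exists f : nat -> T, forall y, exists2 i, i < M & f i = y.

Lemma inj_fin_cover (T : Type) (t0 : T) (C : finType) (f : T -> C) :
  injective f -> fin_cover T #|C|.
Proof.
move=> inj_f.
have hc (c : C) : exists t, forall y, f y = c -> y = t.
  have [[y <-]|n] := pselect (exists y, f y = c); first by exists y => z /inj_f.
  by exists t0 => y yc; case: n; exists y.
have [g hg] := choice hc.
exists (fun i => g (nth (f t0) (enum C) i)) => y; exists (index (f y) (enum C)).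
  by rewrite cardE index_mem mem_enum.
by rewrite nth_index ?mem_enum //; apply/esym/hg.
Qed.

(** Singletons are finite intersections of separating sets, and every set is a finite Boolean
    combination of singletons. *)
Lemma algebra_finite (F : frame) (A : set (set F)) M : algebra A -> fin_cover F M ->
  (forall x y : F, x <> y -> exists2 a, A a & a x /\ ~ a y) -> forall X, A X.
Proof.
move=> algA [f hf] sep X.
have A1 (x : F) : A [set x].
  have hc (y : F) : exists a, [/\ A a, a x & y <> x -> ~ a y].
    have [->|yx] := pselect (y = x).
      by exists setT; split; [apply: algT| |].
    by have [|a Aa [ax ay]] := sep x y; [move=> e; apply: yx|exists a].
  have [Q hQ] := choice hc.
  suff -> : [set x] = [set z | forall i, i \in iota 0 M -> Q (f i) z].
    by apply: alg_all => // i _; case: (hQ (f i)).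
  apply/seteqP; split=> [_ -> i _|z h]; first by case: (hQ (f i)).
  apply: contrapT => zx; have [i iM fi] := hf z; subst z.
  by have [_ _] := hQ (f i); apply=> //; apply: h; rewrite mem_iota.
pose Q i := if `[< X (f i) >] then ~` [set f i] else setT.
suff -> : X = ~` [set z | forall i, i \in iota 0 M -> Q i z].
  apply: algC => //; apply: alg_all => // i _; rewrite /Q.
  by case: asboolP => _; [apply: algC|apply: algT].
apply/seteqP; split=> z.
  move=> Xz h; have [i iM fi] := hf z; subst z; have := h i; rewrite mem_iota iM /Q.
  by case: asboolP => // _ /(_ isT); apply.
move=> /existsNP[i /not_implyP[_]]; rewrite /Q; case: asboolP => [Xi|_]; last by case.
by move=> /contrapT ->.
Qed.

(** * Extensions of the base logic in finitely many variables *)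

Section Extension.
Variables (k l n m : nat) (L : set form).

Hypotheses (tL : tense_logic L) (extL : S4BP k l n m `<=` L).

Lemma S4BP_axiom a : a = bd k \/ a = bz l \/ a = bw_plus n \/ a = bw_minus m -> L a.
Proof. by move=> ha; apply: extL; apply: sub_gen_smallest; right. Qed.

Lemma S4_axiom a : a = Imp (Box (Var 0)) (Var 0) \/
  a = Imp (Box (Var 0)) (Box (Box (Var 0))) -> L a.
Proof.
by move=> ha; apply: extL; apply: sub_gen_smallest; left; apply: sub_gen_smallest; right.
Qed.

(* The axioms of a tense logic do not say that [Past a] implies
   [Past (Neg (Neg a))], but the substitution a, ..., a into bw_minus turns
   [Past a] into the possibility of a negated formula. *)
Lemma past_nn a : L (Imp (Past a) (Past (Neg (Neg a)))).
Proof.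
pose X := And a (Or a (Past a)).
have h1 : L (subst (fun=> a) (bw_minus m)).
  by apply: tl_subst => //; apply: S4BP_axiom; do !right.
have h2 : L (Imp (Past a) (Past X)).
  apply: tl_mp tL _ _ _ h1; apply: (tl_taut tL) => v /=.
  apply/implyP => /implyP h; apply/implyP => va; apply: contraT => vX.
  (* Under the constant substitution every disjunct becomes [Past X], so the disjunction is false
     when [Past X] is. *)
  have nb : ~~ beval v (subst (fun=> a)
      (\big[Or/Bot]_(i < m.+1) \big[Or/Bot]_(j < m.+1 | i != j)
         Past (And (Var i) (Or (Var j) (Past (Var j)))))).
    apply: (big_ind (fun c => ~~ beval v (subst (fun=> a) c))) => //=.
      by move=> c d /negbTE -> /negbTE ->.
    move=> i _; apply: (big_ind (fun c => ~~ beval v (subst (fun=> a) c))) => //=.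
    by move=> c d /negbTE -> /negbTE ->.
  rewrite -(negbTE nb); apply: h.
  apply: (big_ind (fun c => beval v (subst (fun=> a) c))) => //=.
  by move=> c d -> ->.
have h3 : L (Imp (PastBox (Neg a)) (PastBox (Imp a (Neg (Or a (Past a)))))).
  apply: tl_mp tL _ _ (tl_K_pastbox tL _ _) _; apply: (tl_nec_pastbox tL).
  by apply: (tl_taut tL); taut.
apply: tl_mp tL _ _ _ h2; apply: tl_mp tL _ _ _ h3; apply: (tl_taut tL).
by rewrite /X; taut.
Qed.

Variable q : nat.

Definition cut_vars (i : nat) : form := if i < q then Var i else Bot.

(* Modulo this theory every formula is equivalent to one in the first q
   variables. *)
Definition cut_theory : set form := [set a | L (subst cut_vars a)].

Lemma cut_theory_sub : L `<=` cut_theory.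
Proof. by move=> a La; apply: tl_subst. Qed.

Lemma cut_theory_theory : theory cut_theory.
Proof.
split.
- by move=> a ta; apply: cut_theory_sub (tl_taut tL ta).
- by move=> a b; apply: (tl_K_box tL).
- by move=> a b; apply: (tl_K_pastbox tL).
- by move=> a; apply: (tl_box_past tL).
- by move=> a; apply: (tl_pastbox_dia tL).
- by move=> a b; apply: (tl_mp tL).
- by move=> a; apply: (tl_nec_box tL).
- by move=> a; apply: (tl_nec_pastbox tL).
- move=> a; apply: (tl_subst tL (fun=> subst cut_vars a)
    (a := Imp (Box (Var 0)) (Var 0))).
  by apply: S4_axiom; left.
- move=> a; apply: (tl_subst tL (fun=> subst cut_vars a)
    (a := Imp (Box (Var 0)) (Box (Box (Var 0))))).
  by apply: S4_axiom; right.
- by move=> a; apply: past_nn.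
Qed.

Let thT := cut_theory_theory.

Lemma subst_cut_vars a : var_bound a <= q -> subst cut_vars a = a.
Proof.
elim: a => //= [i iq|a IHa b IHb|a IHa|a IHa].
- by rewrite /cut_vars iq.
- by rewrite geq_max => /andP[/IHa -> /IHb ->].
- by move=> /IHa ->.
- by move=> /IHa ->.
Qed.

Lemma subst_Var a : subst Var a = a.
Proof. by elim: a => //= [a -> b ->|a ->|a ->]. Qed.

(** Equivalent points have the same successors and predecessors, so agreement on variables makes
    them bisimilar. Variables from [q] on are false everywhere because the theory replaces them by
    [Bot]. *)
Lemma can_equi_eq x0 (x y : can_frame thT x0) : equi (@acc _) x y ->
  (forall i, i < q -> sval x (Var i) <-> sval y (Var i)) -> x = y.
Proof.
move=> xy hxy.
have hv i : sval x (Var i) <-> sval y (Var i).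
  case: (ltnP i q) => [|qi]; first exact: hxy.
  have nv (z : can_frame thT x0) : ~ sval z (Var i).
    case: z => G mG /=; apply/(mcs_Neg mG)/(fi_sub mG); apply: (tl_taut tL).
    by rewrite /= /cut_vars ltnNge qi.
  by split=> /nv.
have truth a (z : can_frame thT x0) := @canonical_truth _ thT x0 Var a z.
have E a : sval x a <-> sval y a.
  rewrite -(subst_Var a) -!truth.
  apply: (@bisim_sat _ _ _ _ (var_bound a) (fun u v : can_frame thT x0 =>
    u = v \/ equi (@acc _) u v /\ forall i, sval u (Var i) <-> sval v (Var i))) => //.
  - by move=> i u v _ [->|[_ h]] //; apply: h.
  - move=> u v w [->|[[_ vu] _]] uw; exists w; try by left.
      by [].
    exact: acc_trans vu uw.
  - move=> u v w [->|[[uv _] _]] vw; exists w; try by left.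
      by [].
    exact: acc_trans uv vw.
  - move=> u v w [->|[[uv _] _]] wu; exists w; try by left.
      by [].
    exact: acc_trans wu uv.
  - move=> u v w [->|[[_ vu] _]] wv; exists w; try by left.
      by [].
    exact: acc_trans wv vu.
  by right.
case: x y E {xy hxy hv} => [G mG] [D mD] /= E.
by apply: sval_inj; apply/funext => a; apply/propext.
Qed.

End Extension.

(** [a] is refuted in the subframe generated by a maximal consistent set containing [Neg a]; this
    subframe has finitely many clusters, each of them finite. *)
Lemma finite_model_property k l n m (L : set form) (a : form) :
  0 < k -> 0 < l -> tense_logic L -> S4BP k l n m `<=` L -> ~ L a ->
  exists F : frame, [/\ exists M, fin_cover F M, rooted F, L `<=` Log F & ~ Log F a].
Proof.
move=> k0 l0 tL extL na; pose q := var_bound a.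
pose thT := cut_theory_theory tL extL q.
have fa : th_filter (cut_theory L q) [set c | cut_theory L q (Imp (Neg a) c)].
  split=> [c|c d /= h1 h2|h].
  - by apply: (th_taut1 thT); taut.
  - apply: (th_mp thT _ h2); apply: (th_mp thT _ h1); apply: (th_taut thT); taut.
  - apply: na; rewrite -(subst_cut_vars (leqnn q)).
    by move: h; apply: (th_taut1 thT); taut.
have [G mG hG] := lindenbaum thT fa.
have Ga : G (Neg a) by apply/hG/(th_taut thT); taut.
pose x0 : can_carrier (cut_theory L q) := exist _ G mG.
pose C := can_frame thT x0; pose F := gen (x0 : C).
pose A := @gen_restrict C x0 (@definable _ thT x0).
have algA : algebra A by apply/algebra_restrict/algebra_definable.
have tA : tight A by apply/tight_restrict/tight_definable.
have vA b : L b -> valid A b.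
  move=> Lb; apply/valid_restrict/valid_definable => s.
  by apply: (cut_theory_sub tL); apply: (tl_subst tL).
have ax b : b = bd k \/ b = bz l \/ b = bw_plus n \/ b = bw_minus m -> valid A b.
  by move=> hb; apply: vA; apply: (S4BP_axiom extL).
have rF : rooted F by apply: rooted_gen.
have [s [_ hs]] : exists s : seq {classic F}, size s <= cluster_bound k l n m /\
    forall y : F, exists2 w, w \in s & equi (@acc F) y w.
  by apply: (clusters_cover algA tA k0 l0) => //; apply: ax; tauto.
have hc (y : F) : exists z : {classic F}, z \in s /\ equi (@acc F) y z.
  by have [z ? ?] := hs y; exists z.
have [w hw] := choice hc.
(* A point is determined by its cluster and its values on the first [q] variables. *)
pose code (y : F) : 'I_(size s).+1 * {ffun 'I_q -> bool} :=
  (inord (index (w y) s), [ffun i : 'I_q => `[< sval (sval y) (Var i) >]]).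
have inj_code : injective code.
  move=> y z [] /(congr1 val); rewrite /= !inordK ?ltnS ?index_size // => iyz eyz.
  have wyz : w y = w z.
    have [wys _] := hw y; have [wzs _] := hw z.
    by rewrite -(nth_index (w y) wys) iyz nth_index.
  have yz : equi (@acc F) y z.
    have [_ [ywy wyy]] := hw y; have [_ [zwz wzz]] := hw z.
    by rewrite wyz in ywy wyy; split; [apply: acc_trans wzz|apply: acc_trans wyy].
  have : sval y = sval z.
    apply: can_equi_eq; first exact: yz.
    move=> i iq; have := congr1 (fun f : {ffun 'I_q -> bool} => f (Ordinal iq)) eyz.
    by rewrite /= !ffunE => e; apply: asbool_eq_equiv e.
  by move=> /sval_inj.
have covF := inj_fin_cover (gen_root (x0 : C) : F) inj_code.
(* All sets being admissible, validity over [A] is validity on the frame. *)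
have AF X : A X.
  apply: algebra_finite covF _ X => // -[y hy] [z hz] yz.
  have [c [yc zc]] : exists c, sval y c /\ ~ sval z c.
    apply: contrapT => n'; apply: yz.
    have h c : sval y c -> sval z c.
      by move=> yc; apply: contrapT => nzc; apply: n'; exists c.
    apply/sval_inj/sval_inj => /=; apply/funext => c; apply/propext.
    split=> [|zc]; first exact: h.
    apply: contrapT; case: y h {hy n'} => D mD /= h /(mcs_Neg mD)/h.
    by case: z hz h zc => E mE _ h zc /(mcs_Neg mE).
  exists (sval @^-1` [set u : C | sval u c]) => //.
  by exists [set u : C | sval u c] => //; exists c.
exists F; split=> //; first by exists #|{: 'I_(size s).+1 * {ffun 'I_q -> bool}}|.
  by move=> b Lb V x; apply: vA.
move=> /(_ (fun i => sval @^-1` [set y : C | sval y (Var i)]) (gen_root _)).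
move=> /(tm_sat (@gen_t_morphism C x0)) /(@canonical_truth _ thT x0 Var a _).
by rewrite subst_Var /= => h; apply: (fi_con mG (fi_mp mG Ga h)).
Qed.

(** * Skeletons and blow-ups *)

Lemma skeletonP (F : frame) :
  skeleton F <-> forall x y : F, acc x y -> acc y x -> x = y.
Proof.
split=> [sF x y xy yx|h x].
  have : cluster x y by split.
  by rewrite sF.
apply/seteqP; split=> [y [xy yx]|_ ->]; first exact: h.
by split; apply: acc_refl.
Qed.

Section Skel.
Variable G : frame.

Definition skel_carrier := {A : G -> Prop | exists x, A = cluster x}.

Definition skel_proj (x : G) : skel_carrier := exist _ (cluster x) (ex_intro _ x erefl).

Definition skel_repr (A : skel_carrier) : G := sval (cid (svalP A)).

Lemma skel_reprE A : skel_proj (skel_repr A) = A.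
Proof. by apply: sval_inj; rewrite /= /skel_repr; case: cid. Qed.

Definition skel : frame :=
  @Frame skel_carrier (fun A B => acc (skel_repr A) (skel_repr B))
    (let: inhabits x := frame_inhabited G in inhabits (skel_proj x))
    (fun A => acc_refl (skel_repr A))
    (fun A B C => @acc_trans G (skel_repr A) (skel_repr B) (skel_repr C)).

Lemma cluster_equi (x y : G) : cluster x = cluster y <-> equi (@acc G) x y.
Proof.
split=> [e|[xy yx]].
  have : cluster y y by split; apply: acc_refl.
  by rewrite -e => -[].
by apply/seteqP; split=> z [h1 h2]; split; apply: acc_trans; eassumption.
Qed.

Lemma skel_proj_equi x y : skel_proj x = skel_proj y <-> equi (@acc G) x y.
Proof.
split=> [/(congr1 sval)/cluster_equi //|/cluster_equi e].
exact: sval_inj.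
Qed.

Lemma skel_acc x y : @acc skel (skel_proj x) (skel_proj y) <-> acc x y.
Proof.
have [h1 h2] : equi (@acc G) (skel_repr (skel_proj x)) x.
  by apply/skel_proj_equi; rewrite skel_reprE.
have [h3 h4] : equi (@acc G) (skel_repr (skel_proj y)) y.
  by apply/skel_proj_equi; rewrite skel_reprE.
split=> h; last exact: (acc_trans h1 (acc_trans h h4)).
have {}h : acc (skel_repr (skel_proj x)) (skel_repr (skel_proj y)) by [].
exact: (acc_trans h2 (acc_trans h h3)).
Qed.

Lemma skel_skeleton : skeleton skel.
Proof.
apply/skeletonP => A B AB BA.
by rewrite -(skel_reprE A) -(skel_reprE B); apply/skel_proj_equi.
Qed.

Lemma skel_surj : range (skel_proj : G -> skel) = setT.
Proof. by apply: surj_range => A; exists (skel_repr A); apply: skel_reprE. Qed.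

Lemma skel_t_morphism : t_morphism (skel_proj : G -> skel).
Proof.
apply: (pullback_t_morphism (G := skel) (R := @acc skel) (p := skel_proj)
  (p' := id)) skel_surj => //.
by move=> y z; rewrite skel_acc.
Qed.

End Skel.

Definition new_point (F : frame) (x : F) lambda i
    (h : lto (Fin 0) i && leo i lambda) : blowup x lambda :=
  inr (exist (fun i => lto (Fin 0) i && leo i lambda) i h).

Section BlowupTheory.
Variables (F : frame) (x : F).

Lemma blowup_proj_surj lambda :
  range (@blowup_proj F x lambda : blowup x lambda -> F) = setT.
Proof. by apply: surj_range => y; exists (inl y). Qed.

Lemma blowup_proj_t_morphism lambda :
  t_morphism (@blowup_proj F x lambda : blowup x lambda -> F).
Proof.
by apply: (pullback_t_morphism (F := blowup x lambda) (R := @acc F)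
  (p := @blowup_proj F x lambda)
  (p' := id)) (blowup_proj_surj lambda).
Qed.

Lemma rooted_blowup lambda : rooted F -> rooted (blowup x lambda).
Proof.
move=> [r hr]; exists (inl r : blowup x lambda) => u.
have lift y : clos_refl_sym_trans (blowup x lambda) (@acc _) (inl r) (inl y).
  elim: {y}(hr y) => [y z yz|y|y z _ ?|y z t _ ? _ ?].
  - exact: rst_step.
  - exact: rst_refl.
  - exact: rst_sym.
  - exact: rst_trans (inl z) _ _ _.
apply: (rst_trans _ _ _ _ _ (lift (blowup_proj x u))); apply: rst_step.
by case: u => ?; apply: acc_refl.
Qed.

Lemma blowup_fin_TM j : 0 < j -> TM [set blowup x Omega] (blowup x (Fin j)).
Proof.
move=> j0; exists (blowup x Omega) => //.
have hc (u : blowup x Omega) : exists v : blowup x (Fin j),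
    blowup_proj x v = blowup_proj x u /\
    forall w : blowup x (Fin j),
      (match w, u with
       | inl y, inl z => y = z
       | inr i, inr i' => sval i = sval i'
       | _, _ => False
       end) -> v = w.
  (* The new point with index [j] receives all new points that have no counterpart in the finite
     blow-up. *)
  have h0 : lto (Fin 0) (Fin j) && leo (Fin j) (Fin j).
    by rewrite /lto /= -ltnNge j0 leqnn.
  case: u => [y|[i hi]].
    by exists (inl y); split=> // -[z ->|].
  have [ij|nij] := pselect (lto (Fin 0) i && leo i (Fin j)).
    exists (new_point x ij); split=> // -[//|[i' hi']] /= e.
    by congr inr; apply: sval_inj.
  exists (new_point x h0); split=> // -[//|[i' hi']] /= e.
  by case: nij; rewrite -e.
have [g hg] := choice hc.
have sg : range g = setT.
  apply: surj_range => -[y|[i hi]].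
    by exists (inl y); apply: (hg (inl y)).2.
  have h : lto (Fin 0) i && leo i Omega.
    by case/andP: hi => -> _; case: (i).
  by exists (new_point x h); apply: (hg (new_point x h)).2.
exists g => //.
apply: (pullback_t_morphism (F := blowup x Omega) (G := blowup x (Fin j))
  (R := @acc F) (p := @blowup_proj F x Omega)
  (p' := @blowup_proj F x (Fin j))) sg => // u.
by case: (hg u).
Qed.

(* A model on the infinite blow-up is bisimilar, for finitely many variables,
   to one that keeps a point of each type in the cluster of [x]. *)
Lemma Log_blowup_omega (L : set form) :
  (forall i, exists2 j, i <= j & L `<=` Log (blowup x (Fin j))) ->
  L `<=` Log (blowup x Omega).
Proof.
move=> hL b Lb V u; pose q := var_bound b; pose C := {ffun 'I_q -> bool}.
pose idx := {i : ord_omega | lto (Fin 0) i && leo i Omega}.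
(* The type of a new point lists its values on the first [q] variables; [r] will choose a point of
   each realised type. *)
pose typ (i : idx) : C := [ffun t : 'I_q => `[< V t (inr i) >]].
have [i0 _] : {i : idx | True} by exists (exist _ Omega isT).
have hc c : exists r : idx, forall i, typ i = c -> typ r = c.
  have [[i hi]|n] := pselect (exists i, typ i = c); first by exists i.
  by exists i0 => i hi; case: n; exists i.
have [r hr] := choice hc.
have [j jC hj] := hL #|C|.
(* New points are numbered from 1, hence [e.-1]. As [j] is at least the number of types, every type
   gets a point; surplus points take the type of [i0]. *)
pose W t (v : blowup x (Fin j)) : Prop := match v with
  | inl y => V t (inl y)
  | inr i => V t (inr (r (nth (typ i0) (enum C)
               (if sval i is Fin e then e.-1 else 0))))
  end.
pose Z (u : blowup x Omega) (v : blowup x (Fin j)) :=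
  blowup_proj x u = blowup_proj x v /\ forall t, t < q -> V t u <-> W t v.
have tot1 w : exists v, Z w v.
  case: w => [y|i]; first by exists (inl y).
  have he : index (typ i) (enum C) < #|C| by rewrite cardE index_mem mem_enum.
  have h : lto (Fin 0) (Fin (index (typ i) (enum C)).+1) &&
           leo (Fin (index (typ i) (enum C)).+1) (Fin j).
    by rewrite /= (leq_trans he).
  exists (new_point x h); split=> // t tq; rewrite /W /= nth_index ?mem_enum //.
  have := congr1 (fun f : C => f (Ordinal tq)) (hr (typ i) i erefl).
  by rewrite /= !ffunE => e; apply: asbool_eq_equiv; rewrite -e.
have tot2 v : exists w, Z w v.
  case: v => [y|i]; first by exists (inl y).
  by exists (inr (r (nth (typ i0) (enum C) (if sval i is Fin e then e.-1 else 0)))).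
have [v uv] := tot1 u.
apply/(bisim_sat (V := V) (W := W) (q := q) (Z := Z) _ _ _ _ _ (leqnn q) uv)/hj => //.
- by move=> t w v' tq [_]; apply.
- move=> w v' w' [e _] ww'; have [v'' h] := tot1 w'; exists v'' => //.
  by rewrite /= /blowup_acc -e -h.1.
- move=> w v' v'' [e _] ww'; have [w' h] := tot2 v''; exists w' => //.
  by rewrite /= /blowup_acc e h.1.
- move=> w v' w' [e _] ww'; have [v'' h] := tot1 w'; exists v'' => //.
  by rewrite /= /blowup_acc -e -h.1.
- move=> w v' v'' [e _] ww'; have [w' h] := tot2 v''; exists w' => //.
  by rewrite /= /blowup_acc e h.1.
Qed.

End BlowupTheory.

(** Since only [x] lies over [h x], the map extends by the identity on new points and the back
    conditions survive. *)
Lemma blowup_map_Log (F G : frame) (h : F -> G) (x : F) lambda :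
  t_morphism h -> range h = setT -> (forall y, h y = h x -> y = x) ->
  Log (blowup x lambda) `<=` Log (blowup (h x) lambda).
Proof.
move=> th sh hx.
pose g (u : blowup x lambda) : blowup (h x) lambda :=
  match u with inl y => inl (h y) | inr i => inr i end.
have gp u : blowup_proj (h x) (g u) = h (blowup_proj x u) by case: u.
have lift (y : F) (w : blowup (h x) lambda) : h y = blowup_proj (h x) w ->
    exists2 u : blowup x lambda, blowup_proj x u = y & g u = w.
  case: w => [z|i] /= e; first by exists (inl y); rewrite //= e.
  by exists (inr i) => //=; rewrite (hx _ e).
apply: (tm_Log (f := g)).
  apply: t_morphismP => [u v|u w|u w].
  - by move=> /(tm_acc th); rewrite -!gp.
  - rewrite /= /blowup_acc gp => /(tm_succ th)[y uy /lift[v e <-]].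
    by exists v; rewrite ?e.
  - rewrite /= /blowup_acc gp => /(tm_pred th)[y uy /lift[v e <-]].
    by exists v; rewrite ?e.
apply: surj_range => w.
have [y _ /lift[u _ <-]] : range h (blowup_proj (h x) w) by rewrite sh.
by exists u.
Qed.

(** Points of [s] at positions 1 to [j] become the new points, and all other points are sent to
    their clusters. *)
Lemma big_cluster (G : frame) (y0 : G) (j : nat) (s : seq {classic G}) :
  uniq s -> size s = j.+1 ->
  (forall y : G, y \in (s : seq {classic G}) -> equi (@acc G) y y0) ->
  Log G `<=` Log (blowup (skel_proj y0 : skel G) (Fin j)).
Proof.
move=> us ss hs.
pose P (u : G) := lto (Fin 0) (Fin (index (u : {classic G}) s)) &&
  leo (Fin (index (u : {classic G}) s)) (Fin j).
pose g (u : G) : blowup (skel_proj y0 : skel G) (Fin j) :=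
  match pselect (P u) with
  | left h => new_point (skel_proj y0 : skel G) h
  | right _ => inl (skel_proj u)
  end.
have gr (i : nat) (y : {classic G}) (h : lto (Fin 0) (Fin i) && leo (Fin i) (Fin j)) :
    g (nth y s i) = new_point (skel_proj y0 : skel G) h.
  have ei : index (nth y s i) s = i.
    by rewrite index_uniq // ss ltnS; case/andP: h.
  have hP : P (nth y s i) by rewrite /P ei.
  rewrite /g; case: pselect => // h'; congr inr; apply: sval_inj => /=.
  by rewrite ei.
have sg : range g = setT.
  apply: surj_range => -[A|[[i|//] hi]]; last first.
    by exists (nth (y0 : {classic G}) s i); rewrite (gr _ _ hi).
  pose u := skel_repr A; have [h|h] := pselect (P u); last first.
    by exists u; rewrite /g; case: pselect => // ?; rewrite skel_reprE.
  have us' : (u : {classic G}) \in s by rewrite -index_mem ss ltnS; case/andP: h.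
  have vs : nth (u : {classic G}) s 0 \in s by rewrite mem_nth // ss.
  exists (nth (u : {classic G}) s 0); rewrite /g; case: pselect.
    by rewrite /P index_uniq // ss.
  move=> _; congr inl; rewrite -(skel_reprE A); apply/skel_proj_equi.
  have [h1 h2] := hs _ us'; have [h3 h4] := hs _ vs.
  by split; apply: acc_trans; eassumption.
have gp u : blowup_proj (skel_proj y0 : skel G) (g u) = skel_proj u.
  rewrite /g; case: pselect => //= h; apply/esym/skel_proj_equi.
  have us' : (u : {classic G}) \in s by rewrite -index_mem ss ltnS; case/andP: h.
  exact: hs.
apply: (tm_Log (f := g)) => //.
apply: (pullback_t_morphism (F := G)
  (G := blowup (skel_proj y0 : skel G) (Fin j)) (R := @acc (skel G)) (p := @skel_proj G)
  (p' := @blowup_proj (skel G) (skel_proj y0) (Fin j))) => //.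
by move=> y z; rewrite skel_acc.
Qed.

(** * Tabularity *)

Lemma fin_cover_seq (T : Type) (t0 : T) (s : seq {classic T}) M :
  size s <= M -> (forall y : T, (y : {classic T}) \in s) -> fin_cover T M.
Proof.
move=> sM hs; exists (nth (t0 : {classic T}) s) => y.
exists (index (y : {classic T}) s); last by rewrite nth_index.
by rewrite (leq_trans _ sM) // index_mem.
Qed.

Lemma distinct_points (T : Type) (P : set T) p :
  ~ (exists s : seq {classic T}, size s <= p /\
       forall y : T, P y -> (y : {classic T}) \in s) ->
  exists s : seq {classic T}, [/\ uniq s, size s = p.+1 &
    forall y : T, (y : {classic T}) \in s -> P y].
Proof.
move=> n; have : p.+1 <= p.+1 by [].
elim: {1 3}p.+1 => [_|i IH ip]; first by exists [::].
have [s [us ss hs]] := IH (ltnW ip).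
have [y [Py ys]] : exists y : T, P y /\ (y : {classic T}) \notin s.
  apply: contrapT => ny; apply: n; exists s; rewrite ss; split=> // y Py.
  by apply: contraT => ys; case: ny; exists y.
exists ((y : {classic T}) :: s); rewrite /= ys us ss; split=> // z.
by rewrite inE => /orP[/eqP ->|/hs].
Qed.

Lemma fin_cover_finite (T : Type) M : fin_cover T M -> finite_set [set: T].
Proof.
move=> [f hf]; have -> : [set: T] = f @` `I_M.
  by apply/seteqP; split=> // y _; have [i iM <-] := hf y; exists i.
exact/finite_image/finite_II.
Qed.

Lemma finite_fin_cover (T : Type) (t0 : T) :
  finite_set [set: T] -> exists M, fin_cover T M.
Proof.
move=> /finite_setP[n /card_set_bijP[f [ff inj_f _]]].
exists #|'I_n.+1|; apply: (inj_fin_cover t0 (f := fun t => inord (f t) : 'I_n.+1)).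
move=> y z /(congr1 val); rewrite /= !inordK; last 2 first.
- by rewrite ltnS ltnW //; apply: ff.
- by rewrite ltnS ltnW //; apply: ff.
by move=> e; apply: inj_f => //; apply/mem_set.
Qed.

Lemma not_tabular_blowup (F : frame) (x : F) : ~ tabular (Log (blowup x Omega)).
Proof.
move=> [G finG E]; have [g0] := frame_inhabited G.
have [M [f hf]] := finite_fin_cover g0 finG.
(* [b] asks for [M.+1] distinct successors, the [i]-th being the one where [Var i] holds and no
   earlier variable does; a frame with [M] points refutes it. *)
pose b := \big[And/Top]_(i < M.+1)
  Dia (And (Var i) (\big[And/Top]_(j < M.+1 | j < i) Neg (Var j))).
have : Log G (Neg b).
  move=> V u; apply/sat_Neg => /sat_bigAndP h.
  have hc (i : 'I_M.+1) : exists t : 'I_M, V i (f t) /\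
      forall j : 'I_M.+1, j < i -> ~ V j (f t).
    have /sat_Dia[y _ /sat_And[yi /sat_bigAndP yj]] := h i (mem_index_enum _) isT.
    have [t tM e] := hf y; exists (Ordinal tM); rewrite /= e; split=> // j ji.
    exact: (yj j (mem_index_enum _) ji).
  have [t ht] := choice hc.
  suff inj_t : injective t by have := leq_card t inj_t; rewrite !card_ord ltnn.
  have lt (i j : 'I_M.+1) : i < j -> t i <> t j.
    by move=> ij e; case: (ht j) => _ /(_ i ij); rewrite -e; case: (ht i).
  by move=> i j e; apply: val_inj; case: (ltngtP i j) => // /lt; rewrite e.
rewrite -E => h.
have hi (i : nat) : lto (Fin 0) (Fin i.+1) && leo (Fin i.+1) Omega by [].
have /sat_Neg := h (fun i => [set new_point x (hi i)]) (inl x); apply.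
apply/sat_bigAndP => i _ _; apply/sat_Dia; exists (new_point x (hi i)).
  exact: acc_refl.
apply/sat_And; split=> //; apply/sat_bigAndP => j _ ji.
by apply/sat_Neg => -[e]; rewrite e ltnn in ji.
Qed.

(** * Disjoint unions *)

Section Sum.
Variables F G : frame.

Definition sum_acc (u v : F + G) : Prop :=
  match u, v with
  | inl x, inl y => acc x y
  | inr x, inr y => acc x y
  | _, _ => False
  end.

Lemma sum_refl u : sum_acc u u.
Proof. by case: u => x; apply: acc_refl. Qed.

Lemma sum_trans u v w : sum_acc u v -> sum_acc v w -> sum_acc u w.
Proof. by case: u v w => x [] y [] z //=; apply: acc_trans. Qed.

Definition sum_frame : frame :=
  @Frame (F + G)%type sum_acc
    (let: inhabits x := frame_inhabited F in inhabits (inl x)) sum_refl sum_trans.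

Lemma inl_t_morphism : t_morphism (inl : F -> sum_frame).
Proof. by apply: t_morphismP => // y [] w // yw; exists w. Qed.

Lemma inr_t_morphism : t_morphism (inr : G -> sum_frame).
Proof. by apply: t_morphismP => // y [] w // yw; exists w. Qed.

Lemma Log_sum a : Log sum_frame a <-> Log F a /\ Log G a.
Proof.
split=> [h|[hF hG] V [] x]; last 2 first.
- exact/(tm_sat inl_t_morphism)/hF.
- exact/(tm_sat inr_t_morphism)/hG.
split=> V x.
  have /(tm_sat inl_t_morphism) :=
    h (fun i => [set u | if u is inl y then V i y else False]) (inl x).
  exact.
have /(tm_sat inr_t_morphism) :=
  h (fun i => [set u | if u is inr y then V i y else False]) (inr x).
exact.
Qed.

End Sum.

(** Disjoint unions realise intersections of logics; the list is nonempty because frames are. *)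
Lemma tabular_seq (I : eqType) (f : I -> frame) (s : seq I) : s <> [::] ->
  (forall i, i \in s -> finite_set [set: f i]) ->
  exists2 F : frame, finite_set [set: F] &
    forall a, Log F a <-> forall i, i \in s -> Log (f i) a.
Proof.
elim: s => [//|i [|j s] IH] _ hs.
  exists (f i); first by apply: hs; rewrite mem_head.
  move=> a; split=> [h k|]; first by rewrite inE => /eqP ->.
  by apply; rewrite mem_head.
have [//|k ks|F finF hF] := IH; first by apply: hs; rewrite inE ks orbT.
have fini := hs i (mem_head _ _).
exists (sum_frame (f i) F).
  have [x] := frame_inhabited (f i); have [y] := frame_inhabited F.
  have -> : [set: sum_frame (f i) F] = (inl @` [set: f i]) `|` (inr @` [set: F]).
    by apply/seteqP; split=> // -[u|u] _; [left|right]; exists u.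
  by rewrite finite_setU; split; apply: finite_image.
move=> a; rewrite Log_sum hF; split.
  by move=> [h1 h2] k; rewrite inE => /orP[/eqP -> //|]; apply: h2.
by move=> h; split=> [|k ks]; apply: h; rewrite inE ?eqxx // ks orbT.
Qed.

(** * Coding finite frames by tables *)

Definition code_type (M : nat) := {ffun 'I_M * 'I_M -> bool * bool}.

(** Equality is tabulated along with accessibility because the enumeration may repeat points. *)
Definition code (F : frame) (M : nat) (f : nat -> F) : code_type M :=
  [ffun p : 'I_M * 'I_M => (`[< acc (f p.1) (f p.2) >], `[< f p.1 = f p.2 >])].

Lemma code_eq (F G : frame) M (f : nat -> F) (g : nat -> G) :
  (forall y, exists2 i, i < M & f i = y) -> (forall y, exists2 i, i < M & g i = y) ->
  code M f = code M g ->
  exists h : F -> G, [/\ forall i, i < M -> h (f i) = g i,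
    forall y z, acc y z <-> acc (h y) (h z) & range h = setT].
Proof.
move=> hf hg E.
have hE i j : i < M -> j < M ->
    (acc (f i) (f j) <-> acc (g i) (g j)) /\ (f i = f j <-> g i = g j).
  move=> iM jM; have := congr1 (fun c : code_type M => c (Ordinal iM, Ordinal jM)) E.
  rewrite /= !ffunE /= => -[e1 e2].
  by split; [apply: asbool_eq_equiv e1|apply: asbool_eq_equiv e2].
have hc (y : F) : exists w : G, forall i, i < M -> f i = y -> w = g i.
  have [i iM <-] := hf y; exists (g i) => j jM e.
  by apply/esym; apply: (hE j i jM iM).2.1.
have [h hh] := choice hc; have hfg i : i < M -> h (f i) = g i.
  by move=> iM; apply: hh.
exists h; split=> // [y z|].
  have [i iM <-] := hf y; have [j jM <-] := hf z.
  by rewrite !hfg //; apply: (hE i j iM jM).1.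
apply: surj_range => w; have [i iM <-] := hg w.
by exists (f i); apply: hfg.
Qed.

Lemma code_Log (F G : frame) M (f : nat -> F) (g : nat -> G) :
  (forall y, exists2 i, i < M & f i = y) -> (forall y, exists2 i, i < M & g i = y) ->
  code M f = code M g -> Log F `<=` Log G.
Proof.
move=> hf hg E; have [h [_ hh sh]] := code_eq hf hg E.
apply: (tm_Log (f := h)) => //.
by apply: (pullback_t_morphism (R := @acc G) (p := h) (p' := id)).
Qed.

(** By the finite model property [L] is determined by its finite rooted frames, and only finitely
    many codes exist for frames with at most [M] points. *)
Lemma bounded_tabular k l n m (L : set form) M :
  0 < k -> 0 < l -> tense_logic L -> S4BP k l n m `<=` L -> consistent L ->
  (forall G : frame, rooted G -> L `<=` Log G -> (exists N, fin_cover G N) ->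
     fin_cover G M) -> tabular L.
Proof.
move=> k0 l0 tL extL cL hM.
pose good (c : code_type M) (G : frame) := L `<=` Log G /\
  exists2 f : nat -> G, forall y, exists2 i, i < M & f i = y & code M f = c.
have fmp a : ~ L a -> exists c, exists2 G, good c G & ~ Log G a.
  move=> na; have [G [finG rG LG nG]] := finite_model_property k0 l0 tL extL na.
  have [f hf] := hM G rG LG finG.
  by exists (code M f); exists G => //; split=> //; exists f.
have [c0 [G0 _ _]] := fmp Bot cL.
(* Unrealised codes get an arbitrary frame here and are filtered out of [s]. *)
have hc c : exists F, (exists G, good c G) -> good c F.
  have [[G hG]|nG] := pselect (exists G, good c G); first by exists G.
  by exists G0.
have [F hF] := choice hc.
pose s := [seq c <- enum (code_type M) | `[< exists G, good c G >]].
have hs c : c \in s <-> exists G, good c G.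
  by rewrite mem_filter mem_enum andbT; split=> /asboolP.
have [||H finH hH] := @tabular_seq _ F s.
- have [c [G hG _]] := fmp Bot cL.
  have /hs : exists G, good c G by exists G.
  by case: (s).
- move=> c /hs /hF[_ [f hf _]].
  by apply: (@fin_cover_finite _ M); exists f.
exists H => //; apply/seteqP; split=> a.
  by move=> La; apply/hH => c /hs /hF[h _]; apply: h.
move=> /hH h; apply: contrapT => /fmp[c [G hG]]; apply.
have /hs cs : exists G, good c G by exists G.
have /hs/hF[_ [f hf ef]] := cs; case: hG => _ [g hg eg].
by apply: (code_Log hf hg _ (h c cs)); rewrite ef eg.
Qed.

(** * Extensions of the logic of a c-irreducible pre-skeleton *)

(* The characteristic formula of G describes G up to t-morphisms; iterating
   [Delta] often enough turns it into a global condition on H. *)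
Lemma characteristic_formula (G H : frame) M l : fin_cover G M -> rooted G ->
  (forall u v : H, reach (@acc H) l u v) -> Log H `<=` Log G -> TM [set H] G.
Proof.
move=> [f hf] [r hr] hH HG; have [i0 i0M fi0] := hf r.
(* [Var i] names the point [f i]: each point of a model of [body] carries all the names of exactly
   one point of [G] and sees, in both directions, exactly the names that this point sees. *)
pose total := \big[Or/Bot]_(i <- iota 0 M) Var i.
pose B2 i j := Imp (Var i) (if `[< f i = f j >] then Var j else Neg (Var j)).
pose B3 i j := Imp (Var i)
  (if `[< acc (f i) (f j) >] then Dia (Var j) else Neg (Dia (Var j))).
pose B4 i j := Imp (Var i)
  (if `[< acc (f j) (f i) >] then Past (Var j) else Neg (Past (Var j))).
pose body := And total (\big[And/Top]_(i <- iota 0 M) \big[And/Top]_(j <- iota 0 M)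
  And (B2 i j) (And (B3 i j) (B4 i j))).
pose psi := Imp (Neg (iter l Delta (Neg body))) (Neg (Var i0)).
have npsi : ~ Log G psi.
  move=> /(_ (fun i => [set f i]) r) /sat_Imp h.
  suff : sat (fun i => [set f i]) (Neg (iter l Delta (Neg body))) r by move/h; apply.
  apply/sat_Neg => /(sat_iter_Delta (F := G))[y _ /sat_Neg]; apply.
  apply/sat_And; split.
    apply/sat_bigOrP; have [i iM <-] := hf y; exists i; split=> //.
    by rewrite mem_iota.
  apply/sat_bigAndP => i _ _; apply/sat_bigAndP => j _ _.
  apply/sat_And; split; last (apply/sat_And; split); apply/sat_Imp => /= ->.
  - by case: asboolP => // n /= e; apply: n.
  - by case: asboolP => h'; 
      [apply/sat_Dia; exists (f j)|move=> /sat_Dia[z + /= e]; rewrite e].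
  - by case: asboolP => h'; [exists (f j)|move=> [z + /= e]; rewrite e].
have [V [u nu]] : exists V, exists u, ~ sat (F := H) V psi u.
  apply: contrapT => n; apply: npsi; apply: HG => V u; apply: contrapT => nu.
  by apply: n; exists V, u.
have [ub ui0] : sat V (Neg (iter l Delta (Neg body))) u /\ V i0 u.
  have : ~ (sat V (Neg (iter l Delta (Neg body))) u -> ~ V i0 u) by [].
  by move=> /not_implyP[? /contrapT].
have hb v : sat V body v.
  apply: contrapT => nv; apply: ub; apply/(sat_iter_Delta (F := H)).
  by exists v.
have b1 v : exists2 i, i < M & V i v.
  have /sat_And[/sat_bigOrP[i [iM _ hi]] _] := hb v.
  by exists i => //; rewrite mem_iota in iM.
have b2 v i j : i < M -> j < M ->
    [/\ sat V (B2 i j) v, sat V (B3 i j) v & sat V (B4 i j) v].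
  move=> iM jM; have /sat_And[_ /sat_bigAndP h] := hb v.
  have mem t : t < M -> t \in iota 0 M by rewrite mem_iota.
  have /sat_bigAndP/(_ j (mem j jM) isT) := h i (mem i iM) isT.
  by move=> /sat_And[? /sat_And[]].
(* The t-morphism sends [v] to the unique point of [G] named at [v]. *)
have hc v : exists w, forall i, i < M -> V i v <-> f i = w.
  have [i iM vi] := b1 v; exists (f i) => j jM; split=> [vj|e].
    have [/sat_Imp/(_ vi) + _ _] := b2 v i j iM jM.
    by case: asboolP => [-> //|_ /sat_Neg]; case.
  have [/sat_Imp/(_ vi) + _ _] := b2 v i j iM jM.
  by case: asboolP => // n; case: n; rewrite e.
have [g hg] := choice hc.
have tg : t_morphism g.
  apply: t_morphismP => [v v' vv'|v w vw|v w wv].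
  - have [i iM vi] := b1 v; have [j jM vj] := b1 v'.
    have [_ /sat_Imp/(_ vi) + _] := b2 v i j iM jM.
    have /(hg _ i iM) <- := vi; have /(hg _ j jM) <- := vj.
    case: asboolP => // _ /sat_Neg h; case: h; apply/sat_Dia.
    by exists v'.
  - have [i iM vi] := b1 v; have [j jM ej] := hf w.
    have [_ /sat_Imp/(_ vi) + _] := b2 v i j iM jM.
    have /(hg _ i iM) ei := vi; rewrite -ei -ej in vw.
    case: asboolP => // _ /sat_Dia[v' vv' vj]; exists v' => //.
    by rewrite -ej; apply/esym/hg.
  - have [i iM vi] := b1 v; have [j jM ej] := hf w.
    have [_ _ /sat_Imp/(_ vi)] := b2 v i j iM jM.
    have /(hg _ i iM) ei := vi; rewrite -ei -ej in wv.
    case: asboolP => // _ [v' vv' vj]; exists v' => //.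
    by rewrite -ej; apply/esym/hg.
exists H => //; exists g => //; apply: surj_range => w.
have /(hg _ i0 i0M) gu := ui0; rewrite fi0 in gu.
(* The image contains the root and is closed under successors and predecessors, so it is
   everything. *)
suff h y z : clos_refl_sym_trans G (@acc G) y z ->
    (exists v, g v = y) <-> (exists v, g v = z).
  by apply: (h r w (hr w)).1; exists u.
elim=> {y z} [y z yz|y|y z _ h|y z t _ h1 _ h2] //.
- split=> -[v e]; rewrite -e in yz.
    by have [v' _ <-] := tm_succ tg yz; exists v'.
  by have [v' _ <-] := tm_pred tg yz; exists v'.
- by split=> /h.
- by rewrite h1.
Qed.

Lemma isomorphic_sym (F G : frame) : isomorphic F G -> isomorphic G F.
Proof.
move=> [f [g fK gK] hf]; exists g; first by exists f.
by move=> y z; rewrite hf !gK.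
Qed.

Lemma isomorphic_Log (F G : frame) : isomorphic F G -> Log F `<=` Log G.
Proof. by move=> /isomorphic_TM[f tf sf]; apply: tm_Log tf sf. Qed.

Lemma fin_cover_surj (T U : Type) (f : T -> U) M :
  (forall y, exists x, f x = y) -> fin_cover T M -> fin_cover U M.
Proof.
move=> sf [g hg]; exists (f \o g) => y; have [x <-] := sf y.
by have [i iM <-] := hg x; exists i.
Qed.

Lemma fin_cover_leq (T : Type) M N : M <= N -> fin_cover T M -> fin_cover T N.
Proof.
move=> MN [f hf]; exists f => y; have [i iM e] := hf y.
by exists i => //; apply: leq_trans MN.
Qed.

Lemma fin_cover_blowup (F : frame) (x : F) N j :
  fin_cover F N -> fin_cover (blowup x (Fin j)) (N + j).
Proof.
move=> [f hf]; pose P i := lto (Fin 0) (Fin i) && leo (Fin i) (Fin j).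
exists (fun i => if i < N then inl (f i) else
  match pselect (P (i - N).+1) with left h => new_point x h | right _ => inl (f i) end).
move=> [y|[[i|//] hi]].
  by have [i iN <-] := hf y; exists i; rewrite ?iN // (leq_trans iN) ?leq_addr.
case: i hi => [//|i] hi; exists (N + i).
  by rewrite ltn_add2l; case/andP: hi.
rewrite ltnNge leq_addr /=; case: pselect => [h|]; last by rewrite addKn.
by congr inr; apply: sval_inj; rewrite /= addKn.
Qed.

Lemma valid_Log (F : frame) a : Log F a -> valid (F := F) setT a.
Proof. by move=> h V _ x; apply: h. Qed.

Section LogBounds.
Variables (k l n m : nat) (F : frame).
Hypotheses (k0 : 0 < k) (l0 : 0 < l).
Hypothesis (extF : S4BP k l n m `<=` Log F).

Let ax a : a = bd k \/ a = bz l \/ a = bw_plus n \/ a = bw_minus m ->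
  valid (F := F) setT a.
Proof. by move=> ha; apply/valid_Log/(S4BP_axiom extF). Qed.

Lemma Log_depth (x : F) : depth (@acc F) k x.
Proof. by apply: (valid_bd (@tight_setT F) k0); apply: ax; left. Qed.

Lemma Log_reach (x y : F) : rooted F -> reach (@acc F) l x y.
Proof.
by apply: (reach_all (@algebra_setT F) (@tight_setT F) k0 l0); apply: ax; tauto.
Qed.

Lemma Log_clusters : rooted F ->
  exists s : seq {classic F}, size s <= cluster_bound k l n m /\
    forall y : F, exists2 w, w \in s & equi (@acc F) y w.
Proof.
by apply: (clusters_cover (@algebra_setT F) (@tight_setT F) k0 l0); apply: ax; tauto.
Qed.

End LogBounds.

Lemma c_irreducible_pretabular k l n m (F : frame) (x : F) :
  0 < k -> 0 < l -> S4BP k l n m `<=` Log (blowup x Omega) ->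
  skeleton F -> rooted (blowup x Omega) -> c_irreducible x Omega ->
  pretabular (Log (blowup x Omega)).
Proof.
move=> k0 l0 ext /skeletonP sF rH cirr; pose H := blowup x Omega.
split; [exact: consistent_Log|exact: not_tabular_blowup|].
move=> L tL [HL nLH] cL.
have [s [ss hs]] := Log_clusters k0 l0 ext rH.
have [N covF] : exists N, fin_cover F N.
  exists (size s); pose p (u : {classic H}) : {classic F} := blowup_proj x (u : H).
  apply: (@fin_cover_seq _ x (map p s)).
    by rewrite size_map.
  move=> y; have [u us [yu uy]] := hs (inl y); apply/mapP; exists u => //.
  exact: sF.
(* If [L] were valid on arbitrarily large finite blow-ups, it would be valid on the infinite one and
   not be a proper extension. *)
have [j0 hj0] : exists j0, forall j, j0 <= j -> ~ L `<=` Log (blowup x (Fin j)).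
  apply: contrapT => nj; apply/nLH/Log_blowup_omega => i.
  apply: contrapT => ni; apply: nj; exists i => j ij Lj.
  by apply: ni; exists j.
apply: (@bounded_tabular k l n m L (N + j0) k0 l0 tL _ cL).
  by move=> a /ext /HL.
move=> G rG LG [M covG].
have : TM [set H] G.
  apply: (characteristic_formula covG rG (l := l)).
    by move=> u v; apply: (Log_reach k0 l0 ext).
  by move=> a /HL /LG.
(* A blow-up in the first case has index below [j0], as [Omega] would make [L] valid on [H]; images
   of [F] have at most [N] points. *)
rewrite cirr => -[[_ [j jpos ->] /isomorphic_sym iso]|[_ -> [f _ sf]]].
  have LB := subset_trans LG (isomorphic_Log iso).
  case: j jpos iso LB => [j|] jpos iso LB; last by case: nLH.
  have jj0 : j < j0 by rewrite ltnNge; apply/negP => /hj0; apply.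
  have cov : fin_cover (blowup x (Fin j)) (N + j0).
    apply: fin_cover_leq (fin_cover_blowup x j covF).
    by rewrite leq_add2l ltnW.
  case: iso => f [g fK gK] _; apply: (fin_cover_surj (f := g)) cov.
  by move=> y; exists (f y).
apply: (@fin_cover_leq _ N); first exact: leq_addr.
apply: (fin_cover_surj (f := f)) covF => y.
have [z _ <-] : range f y by rewrite sf.
by exists z.
Qed.

(** * Pretabular logics *)

(** A finite [B] is numbered by 1 to its size, an infinite one by all nonzero ordinals up to
    omega. *)
Lemma new_points_enum (T : Type) (B : set T) : B !=set0 -> countable B ->
  exists lambda, lto (Fin 0) lambda /\
  exists b : {i : ord_omega | lto (Fin 0) i && leo i lambda} -> T,
    injective b /\ range b = B.
Proof.
move=> [b0 Bb0] cB.
have build lambda (R : set nat) (e : T -> nat)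
    (num : {i : ord_omega | lto (Fin 0) i && leo i lambda} -> nat) :
    set_bij B R e -> injective num -> range num = R ->
    exists b : {i : ord_omega | lto (Fin 0) i && leo i lambda} -> T,
    injective b /\ range b = B.
  move=> [Be inj_e sur_e] inj_num rnum.
  have hc i : exists t, B t /\ e t = num i.
    have : R (num i) by rewrite -rnum; exists i.
    by move=> /sur_e[t Bt et]; exists t.
  have [b hb] := choice hc; exists b; split=> [i j bij|].
    by apply: inj_num; rewrite -(hb i).2 bij (hb j).2.
  apply/seteqP; split=> [_ [i _ <-]|t Bt]; first by case: (hb i).
  have : range num (e t) by rewrite rnum; apply: Be.
  move=> [i _ ei]; exists i => //.
  by apply: inj_e; rewrite ?(hb i).2 //; apply/mem_set => //; case: (hb i).
have [finB|infB] := pselect (finite_set B); last first.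
  have /card_set_bijP[e be] := eq_card_nat cB infB.
  exists Omega; split=> //.
  (* The index [Omega] takes the number 0, which is free because finite indices start at 1. *)
  pose num (i : {i : ord_omega | lto (Fin 0) i && leo i Omega}) :=
    if sval i is Fin n then n else 0.
  apply: (build Omega setT e num) => //.
    move=> [[i|] hi] [[j|] hj]; rewrite /num /= => eij; apply: sval_inj => //=.
    - by rewrite eij.
    - by subst i.
    - by subst j.
  apply: surj_range => -[|n]; first by exists (exist _ Omega isT).
  by exists (exist _ (Fin n.+1) isT).
have /finite_setP[n /card_set_bijP[e be]] := finB.
have n0 : 0 < n.
  by have [Be _ _] := be; apply: leq_ltn_trans (Be b0 Bb0).
exists (Fin n); split; first by rewrite /lto /= -ltnNge.
pose num (i : {i : ord_omega | lto (Fin 0) i && leo i (Fin n)}) :=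
  if sval i is Fin j then j.-1 else 0.
apply: (build (Fin n) `I_n e num) => //.
  move=> [[[|i]|] hi] [[[|j]|] hj] //; rewrite /num /= => eij.
  by apply: sval_inj => /=; rewrite eij.
apply/seteqP; split=> [_ [[[[|i]|] hi] _ <-]|i /= iN] //.
by exists (exist _ (Fin i.+1) iN).
Qed.

(** After [y] is removed from a duplicate-free list of [S], the images still cover [T], because [z]
    stands in for [y]. *)
Lemma merged_cover (S T : Type) (h : S -> T) (M : nat) (y z : S) :
  (forall w, exists x, h x = w) -> fin_cover S M -> y <> z -> h y = h z ->
  exists2 N, N < M & fin_cover T N.
Proof.
move=> sh [f hf] yz hyz.
pose s : seq {classic S} := undup [seq f i : {classic S} | i <- iota 0 M].
have ms (x : S) : (x : {classic S}) \in s.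
  by have [i iM <-] := hf x; rewrite mem_undup map_f // mem_iota.
have sM : size s <= M by rewrite (leq_trans (size_undup _)) // size_map size_iota.
have s0 : 0 < size s by move: (ms y); case: (s).
pose p (u : {classic S}) : {classic T} := h (u : S).
pose t := map p (rem (y : {classic S}) s).
exists (size t).
  by rewrite size_map (size_rem (ms y)) prednK.
apply: (@fin_cover_seq _ (h y) t) => // w; have [x <-] := sh w.
have mt (x' : S) : x' <> y -> (h x' : {classic T}) \in t.
  move=> x'y; apply: (@map_f _ _ p); rewrite mem_rem_uniq ?undup_uniq // inE.
  by apply/andP; split=> //; apply/eqP.
have [->|] := pselect (x = y); last exact: mt.
by rewrite hyz; apply: mt => e; apply: yz.
Qed.

Lemma TM_comp (H F G : frame) (f : F -> G) :
  t_morphism f -> range f = setT -> TM [set H] F -> TM [set H] G.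
Proof.
move=> tf sf [_ -> [g tg sg]]; exists H => //; exists (f \o g).
  exact: t_morphism_comp.
exact: (range_compT sg sf).
Qed.

(** * Images of an infinite pre-skeleton *)

Section Image.
Variables (S : frame) (x : S) (k : nat).
Hypothesis sS : skeleton S.
Let H := blowup x Omega.
Hypothesis depH : forall u : H, depth (@acc H) k u.

Variables (G : frame) (f : H -> G).
Hypotheses (tf : t_morphism f) (sf : range f = setT).

Let fx := f (inl x).

(** A map constant on the cluster of [x] factors through the projection. *)
Lemma image_collapse : (forall i, f (inr i) = fx) -> TM [set S] G.
Proof.
move=> fC; have fp u : f u = f (inl (blowup_proj x u)) by case: u.
exists S => //; exists (fun y => f (inl y)).
  apply: t_morphismP => [y z yz|y w|y w].
  - exact: (@tm_acc _ _ _ tf (inl y) (inl z)).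
  - move=> /(tm_succ tf)[u yu <-]; exists (blowup_proj x u) => //.
  - move=> /(tm_pred tf)[u yu <-]; exists (blowup_proj x u) => //.
apply: surj_range => w; have [u <-] := tm_surj sf w.
by exists (blowup_proj x u); exact: (esym (fp u)).
Qed.

Variable i1 : {i : ord_omega | lto (Fin 0) i && leo i Omega}.
Hypothesis fi1 : f (inr i1) <> fx.

Lemma new_equi i : equi (@acc G) (f (inr i)) fx.
Proof. by split; apply: (tm_acc tf); apply: acc_refl. Qed.

(* A maximal point mapped into the cluster of [fx] sees points of its own
   cluster mapped to two distinct points, so it lies over [x]. *)
Lemma extremal_point (R : H -> H -> Prop) (RG : G -> G -> Prop) :
  (forall u, R u u) -> (forall u v w, R u v -> R v w -> R u w) ->
  (forall u, depth R k u) ->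
  (forall u w, RG (f u) w -> exists2 v, R u v & f v = w) ->
  (forall a b, equi (@acc G) a b -> RG a b) ->
  (forall u v, R u v -> R v u -> blowup_proj x u = blowup_proj x v) ->
  forall u, equi (@acc G) (f u) fx -> exists2 v, R u v & blowup_proj x v = x.
Proof.
move=> rR tR dR lift eRG eR u ufx.
have tG := @acc_trans G.
have [v [uv vfx vmax]] :=
  depth_maximal (P := [set v | equi (@acc G) (f v) fx]) rR tR (dR u) ufx.
exists v => //; have [v1 vv1 fv1] := lift v _ (eRG _ _ vfx).
have [v2 vv2 fv2] : exists2 v2, R v v2 & f v2 = f (inr i1).
  apply/lift/eRG; have [h1 h2] := new_equi i1; have [h3 h4] := vfx.
  by split; apply: tG; eassumption.
have e1 : blowup_proj x v1 = blowup_proj x v.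
  by apply: eR => //; apply: vmax => //=; rewrite fv1; split; apply: acc_refl.
have e2 : blowup_proj x v2 = blowup_proj x v.
  by apply: eR => //; apply: vmax => //=; rewrite fv2; apply: new_equi.
(* Two old points over the same point coincide and would have the same image, so [v1] or [v2] is a
   new point and lies over [x]. *)
case: v1 e1 fv1 {vv1} => [y1|i] /= e1 fv1; last by rewrite -e1.
case: v2 e2 fv2 {vv2} => [y2|i] /= e2 fv2; last by rewrite -e2.
by case: fi1; rewrite -fv1 -fv2 e1 e2.
Qed.

(** Such a [u] lies between two points over [x], by [extremal_point] upwards and downwards, and the
    skeleton is antisymmetric. *)
Lemma image_cluster u : equi (@acc G) (f u) fx -> blowup_proj x u = x.
Proof.
move=> ufx; have /skeletonP sk := sS.
have [v uv vx] : exists2 v, acc u v & blowup_proj x v = x.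
  apply: (extremal_point (R := @acc H) (RG := @acc G)) ufx => //.
  - exact: acc_refl.
  - exact: acc_trans.
  - exact: (tm_succ tf).
  - by move=> a b [].
  - by move=> y z ? ?; apply: sk.
have [w wu wx] : exists2 v, acc v u & blowup_proj x v = x.
  apply: (extremal_point (R := converse (@acc H)) (RG := converse (@acc G))) ufx => //.
  - exact: acc_refl.
  - by move=> a b c ba cb; apply: acc_trans cb ba.
  - exact: depth_converse.
  - exact: (tm_pred tf).
  - by move=> a b [].
  - by move=> y z ? ?; apply: sk.
by apply: sk; [rewrite -[X in acc _ X]vx|rewrite -[X in acc X _]wx].
Qed.

Definition image_skel (y : S) : skel G := skel_proj (f (inl y)).

Lemma image_skelE u : image_skel (blowup_proj x u) = skel_proj (f u).
Proof.
case: u => [//|i]; apply/skel_proj_equi.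
by have [? ?] := new_equi i; split.
Qed.

Lemma image_skel_t_morphism : t_morphism image_skel.
Proof.
apply: t_morphismP => [y z yz|y A|y A].
- by apply/skel_acc; apply: (@tm_acc _ _ _ tf (inl y) (inl z)).
- rewrite -(skel_reprE A) => /skel_acc/(tm_succ tf)[u yu <-].
  by exists (blowup_proj x u); rewrite ?image_skelE.
- rewrite -(skel_reprE A) => /skel_acc/(tm_pred tf)[u yu <-].
  by exists (blowup_proj x u); rewrite ?image_skelE.
Qed.

Lemma image_skel_surj A : exists y, image_skel y = A.
Proof.
have [u e] := tm_surj sf (skel_repr A); exists (blowup_proj x u).
by rewrite image_skelE e skel_reprE.
Qed.

Lemma image_skel_x y : image_skel y = image_skel x -> y = x.
Proof. by move=> /skel_proj_equi/image_cluster. Qed.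

(** [G] has a nontrivial cluster only at [fx], and [B] collects its further points. They are
    countably many, hence index the new points of a blow-up. *)
Lemma image_IM : injective image_skel ->
  IM [set G' | exists2 j, lto (Fin 0) j && leo j Omega & G' = blowup x j] G.
Proof.
move=> inj_h; pose B := [set b | b <> fx /\ exists i, f (inr i) = b].
have hfin i : lto (Fin 0) (Fin i.+1) && leo (Fin i.+1) Omega by [].
have cB : countable B.
  pose e n := if n is i.+1 then f (new_point x (hfin i))
              else f (@new_point S x Omega Omega isT).
  suff Be : B `<=` e @` setT.
    exact: card_le_trans (subset_card_le Be) (card_image_le _ _).
  move=> b [_ [[[[|i]|] hi] <-]] //.
    by exists i.+1 => //; congr (f (inr _)); apply: sval_inj.
  by exists 0 => //; congr (f (inr _)); apply: sval_inj.
have [|lambda [l0 [b [inj_b rb]]]] := new_points_enum _ cB.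
  by exists (f (inr i1)); split=> //; exists i1.
exists (blowup x lambda).
  by exists lambda => //; rewrite l0; case: (lambda).
have Bb i : B (b i) by rewrite -rb; exists i.
pose g (u : blowup x lambda) : G := match u with inl y => f (inl y) | inr i => b i end.
have gE u : skel_proj (g u) = image_skel (blowup_proj x u).
  case: u => [//|i] /=; have [_ [i' <-]] := Bb i.
  by rewrite -[x in RHS]/(blowup_proj x (inr i' : H)) image_skelE.
have inj_g : injective g.
  move=> u v e; have := congr1 (@skel_proj G) e; rewrite !gE => /inj_h.
  case: u v e => [y|i] [z|j] /= e.
  - by move=> ->.
  - by move=> yx; case: (Bb j) => -[]; rewrite -e yx.
  - by move=> xz; case: (Bb i) => -[]; rewrite e -xz.
  - by rewrite (inj_b _ _ e).
have sg w : exists u, g u = w.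
  have [[y|i] <-] := tm_surj sf w; first by exists (inl y).
  have [e|ne] := pselect (f (inr i) = fx); first by exists (inl x).
  have [j _ e] : range b (f (inr i)) by rewrite rb; split=> //; exists i.
  by exists (inr j).
exists g; last first.
  move=> u v; rewrite -[acc (g u) _]skel_acc !gE; split.
    exact: (tm_acc image_skel_t_morphism).
  by move=> /(tm_succ image_skel_t_morphism)[z uz /inj_h e]; rewrite /= /blowup_acc -e.
have [g' hg'] := choice sg; exists g' => [u|w]; last exact: hg'.
by apply: inj_g; rewrite hg'.
Qed.

End Image.

(** * Minimal pre-skeletons of a pretabular logic *)

Section Pretabular.
Variables (k l n m : nat) (L : set form).
Hypotheses (k0 : 0 < k) (l0 : 0 < l).
Hypotheses (tL : tense_logic L) (extL : S4BP k l n m `<=` L).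

Let good (F : frame) (x : F) (M : nat) :=
  [/\ skeleton F, rooted F, fin_cover F M & L `<=` Log (blowup x Omega)].

(** If the induced map on [S] merged two points, the skeleton of the image would be a candidate with
    fewer points. *)
Lemma minimal_c_irreducible (S : frame) (x : S) M : good x M ->
  (forall (S' : frame) (x' : S') N, good x' N -> M <= N) -> c_irreducible x Omega.
Proof.
move=> [sS rS covS LS] minM; pose H := blowup x Omega.
have depH (u : H) : depth (@acc H) k u.
  by apply: (Log_depth (l := l) (n := n) (m := m) k0) => a /extL /LS.
apply/seteqP; split=> G.
  move=> [_ -> [f tf sf]].
  have [fC|/existsNP[i1 fi1]] := pselect (forall i, f (inr i) = f (inl x)).
    by right; apply: image_collapse fC.
  left; apply: (image_IM tf sf fi1) => y z e; apply: contrapT => yz.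
  have sh := image_skel_surj tf sf.
  have th := image_skel_t_morphism tf.
  have [N NM covN] := merged_cover sh covS yz e.
  suff : M <= N by rewrite leqNgt NM.
  apply: (minM _ (image_skel f x)); split=> //.
  - exact: skel_skeleton.
  - by apply: (tm_rooted th) => //; apply: surj_range.
  - apply: subset_trans LS _; apply: blowup_map_Log => //; first exact: surj_range.
    exact: (image_skel_x sS depH tf fi1).
(* This inclusion holds for any pre-skeleton: the infinite blow-up maps onto the smaller ones and
   onto [S]. *)
move=> [[_ [j jpos ->] /isomorphic_TM[f tf sf]]|[_ -> [f tf sf]]].
  apply: (TM_comp tf sf); case: j jpos {f tf sf} => [j|] jpos.
    by apply: blowup_fin_TM; case/andP: jpos; rewrite /lto /= -ltnNge.
  exists H => //; exists id; last by apply: surj_range => u; exists u.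
  by apply: t_morphismP => // u w ?; exists w.
apply: (TM_comp tf sf); exists H => //; exists (@blowup_proj S x Omega).
  exact: blowup_proj_t_morphism.
exact: blowup_proj_surj.
Qed.

(** Otherwise all clusters of rooted frames for [L] have at most [j] points; this bounds the size of
    those frames, and [L] is tabular. *)
Lemma big_clusters j : consistent L -> ~ tabular L -> exists (S : frame) (x : S),
  [/\ skeleton S, rooted S, fin_cover S (cluster_bound k l n m) &
      L `<=` Log (blowup x (Fin j))].
Proof.
move=> cL ntL; apply: contrapT => nS; apply: ntL.
apply: (@bounded_tabular k l n m L (cluster_bound k l n m * j)) => //.
move=> G rG LG _.
have [s [ss hs]] : exists s : seq {classic G}, size s <= cluster_bound k l n m /\
    forall y : G, exists2 w, w \in s & equi (@acc G) y w.
  by apply: (Log_clusters k0 l0) => // a /extL /LG.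
have [r _] := rG.
have hc (w : {classic G}) : exists t : seq {classic G}, size t <= j /\
    forall y : G, equi (@acc G) y w -> (y : {classic G}) \in t.
  apply: contrapT => /distinct_points[t [ut st ht]]; apply: nS.
  exists (skel G), (skel_proj (w : G)); split.
  - exact: skel_skeleton.
  - by apply: tm_rooted rG; [apply: skel_t_morphism|apply: skel_surj].
  - pose p (u : {classic G}) : {classic (skel G)} := skel_proj (u : G).
    apply: (@fin_cover_seq _ (skel_proj r) (map p s)); first by rewrite size_map.
    move=> A; have [u us hu] := hs (skel_repr A); apply/mapP; exists u => //.
    by rewrite -[LHS]skel_reprE; apply/skel_proj_equi.
  - by apply: subset_trans LG _; apply: big_cluster ut st ht.
have [t ht] := choice hc.
apply: (@fin_cover_seq _ r (flatten [seq t w | w <- s])).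
  rewrite (leq_trans _ (leq_mul ss (leqnn j))) //.
  elim: s {ss hs} => [//|w s IH] /=.
  by rewrite size_cat mulSn leq_add // (ht w).1.
move=> y; have [w ws yw] := hs y; apply/flatten_mapP; exists w => //.
exact: (ht w).2.
Qed.

Lemma exists_blowup : consistent L -> ~ tabular L ->
  exists M (S : frame) (x : S), good x M.
Proof.
(* The additional position lets enumerations start at the distinguished point, so that codes record
   it. *)
move=> cL ntL; pose M := (cluster_bound k l n m).+1.
pose P j (S : frame) (f : nat -> S) := [/\ skeleton S, rooted S,
  forall y, exists2 i, i < M & f i = y & L `<=` Log (blowup (f 0) (Fin j))].
have hc j : exists c, exists (S : frame) (f : nat -> S), P j S f /\ code M f = c.
  have [S [x [sS rS [f hf] LS]]] := big_clusters j cL ntL.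
  pose f' i := if i is i'.+1 then f i' else x.
  exists (code M f'), S, f'; split=> //; split=> // y.
  by have [i iM <-] := hf y; exists i.+1.
have [c hcc] := choice hc.
(* Pigeonhole: some code recurs for arbitrarily large [j], for otherwise an index beyond the bounds
   of all codes would have none. *)
have [c0 hc0] : exists c0, forall i, exists2 j, i <= j & c j = c0.
  apply: contrapT => nc.
  have hb d : exists i, forall j, i <= j -> c j <> d.
    apply: contrapT => nd; apply: nc; exists d => i; apply: contrapT => ni.
    by apply: nd; exists i => j ij e; apply: ni; exists j.
  have [b hbb] := choice hb.
  exact: (hbb _ _ (leq_bigmax (F := b) (c (\max_d b d)))).
have [j0 _ cj0] := hc0 0; have [S [f [[sS rS hf _] ef]]] := hcc j0.
exists M, S, (f 0); split=> //; first by exists f.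
apply: Log_blowup_omega => i; have [j ij cj] := hc0 i; exists j => //.
have [S' [f' [[/skeletonP sS' _ hf' LS'] ef']]] := hcc j.
(* Equal codes give a map between the skeletons that preserves the distinguished point, so the
   blow-ups may be taken over the single [S]. *)
have [|h [h0 hh sh]] := code_eq hf' hf; first by rewrite ef ef' cj0 cj.
rewrite -(h0 0) //; apply: subset_trans LS' _; apply: blowup_map_Log => //.
  by apply: (pullback_t_morphism (R := @acc S) (p := h) (p' := id)).
by move=> y e; apply: sS'; apply/hh; rewrite e; apply: acc_refl.
Qed.

Lemma pretabular_c_irreducible : pretabular L ->
  exists (F : frame) (x : F),
    [/\ skeleton F, rooted (blowup x Omega), c_irreducible x Omega &
        L = Log (blowup x Omega)].
Proof.
move=> [cL ntL extT].
have ex : exists M, `[< exists (S : frame) (x : S), good x M >].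
  by have [M ?] := exists_blowup cL ntL; exists M; apply/asboolP.
have [M /asboolP[S [x gx]] minM] := ex_minnP ex.
have cirr : c_irreducible x Omega.
  apply: (minimal_c_irreducible gx) => S' x' N gx'.
  by apply: minM; apply/asboolP; exists S', x'.
have [sS rS _ LS] := gx; exists S, x; split=> //; first exact: rooted_blowup.
(* Were the inclusion strict, pretabularity of [L] would make the logic of the infinite blow-up
   tabular. *)
apply/seteqP; split=> //; apply: contrapT => nSL.
apply: (@not_tabular_blowup _ x); apply: extT.
- exact: tense_logic_Log.
- by split.
- exact: consistent_Log.
Qed.

End Pretabular.

Theorem theorem5p16 (k l n m : nat)
    (hk : 0 < k) (hl : 0 < l) (hn : 0 < n) (hm : 0 < m)
    (L : set form) (tL : tense_logic L) (extL : S4BP k l n m `<=` L) :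
  pretabular L <->
  exists (F : frame) (x : F),
    [/\ skeleton F, rooted (blowup x Omega), c_irreducible x Omega &
        L = Log (blowup x Omega)].
Proof.
split; first exact: pretabular_c_irreducible hk hl tL extL.
move=> [F [x [sF rF cF E]]]; rewrite E.
by apply: (@c_irreducible_pretabular k l n m) => //; rewrite -E.
Qed.
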